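(* Let $\lambda,\mu$ be partitions with at most $n$ parts and $\mu\subseteq\lambda$, and let $\mathbf r,\mathbf s\in\mathbb Z_{>0}^n$ be such that $r_i-\mu_i\le r_{i+1}-\mu_{i+1}$ and $s_i-\lambda_i\le s_{i+1}-\lambda_{i+1}+1$ whenever $\mu_i<\lambda_{i+1}$ ($1\le i\le n-1$). Then \[ G^{\mathrm{col}(\mathbf r,\mathbf s)}_{\lambda'/\mu'}(\mathbf x;\boldsymbol\alpha,\boldsymbol\beta)=D\det\Big(e_{\lambda_i-\mu_j-i+j}\big[X_{[r_j,s_i]}\ominus(A_{i-1}-A_j-B_{\lambda_i}+B_{\mu_j})\big]\Big)_{i,j=1}^n,\qquad D=\prod_{i=1}^n\prod_{l=r_i}^{s_i}(1-\alpha_ix_l)^{-1}. \]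
   Context: $\lambda',\mu'$ denote transposed partitions. Parameters $\boldsymbol\alpha,\boldsymbol\beta$; $A_k=\alpha_1+\dots+\alpha_k$, $B_k=\beta_1+\dots+\beta_k$ for $k\ge1$, $A_k=B_k=0$ for $k\le0$; $X_{[r,s]}=x_r+\dots+x_s$ ($=0$ if $r>s$). For a formal $\mathbb Z$-linear combination $Z=\sum_uc_uu$ of variables/parameters, $\sum_{m\ge0}e_m[Z]t^m=\prod_u(1+ut)^{c_u}$, $e_m[Z]=0$ for $m<0$; for two such combinations and any integer $m$, $e_m[Y\ominus W]=\sum_{a,b\ge0,\,a-b=m}e_a[Y]e_b[W]$. A marked multiset-valued tableau of shape $\lambda'/\mu'$ is a filling $T$ of each cell $(i,j)$ (row $i$, column $j$) with a nonempty multiset $\{a_1\le\dots\le a_k\}$ of positive integers, in which each $a_t$ with $t\ge2$ and $a_{t-1}<a_t$ may be marked, such that $\max T(i,j)\le\min T(i,j+1)$ and $\max T(i,j)<\min T(i+1,j)$ whenever the cells lie in the shape. Weight: $\mathrm{wt}(T)=\prod_{(i,j)}\mathbf x^{T(i,j)}\alpha_j^{u(T(i,j))-1}(-\beta_i)^{m(T(i,j))}$, where $\mathbf x^{T(i,j)}$ is the product of $x_k$ over all elements of $T(i,j)$ with multiplicity, and $u$, $m$ count unmarked and marked elements. $G^{\mathrm{col}(\mathbf r,\mathbf s)}_{\lambda'/\mu'}(\mathbf x;\boldsymbol\alpha,\boldsymbol\beta)$ is the sum of $\mathrm{wt}(T)$ over such tableaux with $r_j\le\min T(i,j)$ and $\max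 T(i,j)\le s_j$ for all cells $(i,j)$. *)

(* Defs.v *)
From HB Require Import structures.
From mathcomp Require Import all_boot all_order all_algebra.
From mathcomp Require Import finmap.
From mathcomp Require Import boolp classical_sets functions cardinality fsbigop.
From mathcomp Require Import monalg.

Set Implicit Arguments.
Unset Strict Implicit.
Unset Printing Implicit Defensive.

Import Order.TTheory GRing.Theory Num.Theory.

Local Open Scope classical_set_scope.
Local Open Scope ring_scope.

(* Formal power series in arbitrarily many commuting variables [V]: all
   functions from monomials to coefficients. *)
Record mseries (R : nzRingType) (V : choiceType) :=
  MSeries { mscoef :> {cmonom V} -> R }.

HB.instance Definition _ R V := gen_eqMixin (mseries R V).
HB.instance Definition _ R V := gen_choiceMixin (mseries R V).

Section MSeries.
Context {R : comNzRingType} {V : choiceType}.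
Local Notation S := (mseries R V).
Implicit Types (f g h : S) (m k l : {cmonom V}).

Lemma mseriesP f g : (forall m, f m = g m) -> f = g.
Proof. by case: f g => f [g] /= /funext ->. Qed.

Definition msC (c : R) : S := MSeries (fun m => if m == mone then c else 0).

Definition msX (v : V) : S := MSeries (fun m => (m == ucm v)%:R).

Definition msadd f g : S := MSeries (fun m => f m + g m).
Definition msopp f : S := MSeries (fun m => - f m).
(* The index set below is finite for every [m], see [finite_factor]. *)
Definition msmul f g : S := MSeries (fun m =>
  \sum_(p \in [set p : {cmonom V} * {cmonom V} | mmul p.1 p.2 = m])
     f p.1 * g p.2).

Lemma msaddA : associative msadd.
Proof. by move=> f g h; apply: mseriesP => m /=; rewrite addrA. Qed.
Lemma msaddC : commutative msadd.
Proof. by move=> f g; apply: mseriesP => m /=; rewrite addrC. Qed.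
Lemma msadd0 : left_id (msC 0) msadd.
Proof. by move=> f; apply: mseriesP => m /=; rewrite if_same add0r. Qed.
Lemma msaddN : left_inverse (msC 0) msopp msadd.
Proof. by move=> f; apply: mseriesP => m /=; rewrite if_same addNr. Qed.

HB.instance Definition _ :=
  GRing.isZmodule.Build (mseries R V) msaddA msaddC msadd0 msaddN.

Lemma finite_divisor m : finite_set [set k | exists l, mmul k l = m].
Proof.
pose F (a : {ffun finsupp m -> 'I_(mdeg m).+1}) : {cmonom V} :=
  mkcmonom [fsfun i : finsupp m => nat_of_ord (a i) | 0%N].
apply: (@sub_finite_set _ _ (F @` setT)); last exact/finite_image/finite_finset.
move=> k [l klm] /=.
have kE i : (k i <= mdeg k)%N.
  rewrite mdegE; case: (mdomP k i) => [ki|//].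
  by rewrite (big_fsetD1 i) //= leq_addr.
exists [ffun i => inord (k (val i))] => //; apply/eqP/cmP => i.
rewrite /F cmE fsfun_ffun; case: insubP => [u ui uE|].
  by rewrite /= ffunE uE inordK // -klm mdegM ltnS (leq_trans (kE i)) // leq_addr.
by rewrite -klm mdomD inE negb_or => /andP[]; rewrite -cmE_eq0 => /eqP->.
Qed.

Lemma finite_factor m :
  finite_set [set p : {cmonom V} * {cmonom V} | mmul p.1 p.2 = m].
Proof.
apply: (@sub_finite_set _ _
  ([set k | exists l, mmul k l = m] `*` [set k | exists l, mmul k l = m])).
  move=> [k l] /= <-; split=> /=; first by exists l.
  by exists k; rewrite mulmC.
by apply: finite_setX; apply: finite_divisor.
Qed.

Local Notation divs m := (fset_set [set k | exists l, mmul k l = m]).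

Lemma mem_divsl k l : k \in divs (mmul k l).
Proof. by rewrite in_fset_set ?inE; [exists l|apply: finite_divisor]. Qed.
Lemma mem_divsr k l : l \in divs (mmul k l).
Proof. by rewrite mulmC mem_divsl. Qed.

Lemma msmulE (D : {fset {cmonom V}}) m f g : {subset divs m <= D} ->
  msmul f g m = \sum_(k <- D) \sum_(l <- D | mmul k l == m) f k * g l.
Proof.
move=> sD /=.
pose r := [seq p <- [seq (k, l) | k <- D, l <- D] | mmul p.1 p.2 == m].
rewrite (@fsbigE _ _ _ _ _ r); first last.
- move=> [k l] /= klm; rewrite mem_filter /= klm eqxx /= => /negP[].
  apply/allpairsP; exists (k, l) => /=.
  by rewrite -klm in sD; split=> //; apply: sD; rewrite ?mem_divsl ?mem_divsr.
- by move=> p /=; rewrite mem_filter => /andP[/eqP].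
- apply/filter_uniq/allpairs_uniq; [exact: fset_uniq|exact: fset_uniq|].
  by move=> [? ?] [? ?].
rewrite big_filter_cond big_mkcond big_allpairs_dep /=.
apply: eq_bigr => k _; rewrite [RHS]big_mkcond; apply: eq_bigr => l _ /=.
congr (if _ then _ else _); apply/andP/idP => [[]//|kl].
by split=> //; rewrite inE /=; apply/eqP.
Qed.

Lemma msmulC : commutative msmul.
Proof.
move=> f g; apply: mseriesP => m.
rewrite !(@msmulE (divs m)) // (exchange_big_dep xpredT) //=.
apply: eq_bigr => k _; apply: eq_big => l; first by rewrite mulmC.
by rewrite mulrC.
Qed.

Lemma msmulDl : left_distributive msmul msadd.
Proof.
move=> f g h; apply: mseriesP => m.
transitivity (msmul f h m + msmul g h m); last by [].
rewrite !(@msmulE (divs m)) //.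
rewrite -big_split /=; apply: eq_bigr => k _.
by rewrite -big_split /=; apply: eq_bigr => l _; rewrite mulrDl.
Qed.

Lemma msmul1 : left_id (msC 1) msmul.
Proof.
move=> f; apply: mseriesP => m; rewrite (@msmulE (divs m)) //.
have := mem_divsl mone m; have := mem_divsr mone m; rewrite mul1m => mD oD.
rewrite (big_fsetD1 mone) //=.
rewrite [X in _ + X]big_seq [X in _ + X]big1 ?addr0.
  rewrite big_mkcond (big_fsetD1 m) //= mul1m !eqxx mul1r big_seq big1 ?addr0 //.
  by move=> l; rewrite !inE mul1m => /andP[/negPf->].
move=> k /fsetD1P[/negPf kN1 _]; apply: big1 => l _.
by rewrite /msC /= kN1 mul0r.
Qed.
Lemma msmul3 f g h m : msmul f (msmul g h) m =
  \sum_(k <- divs m) \sum_(a <- divs m) \sum_(b <- divs m)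
    (if mmul k (mmul a b) == m then f k * (g a * h b) else 0).
Proof.
rewrite (@msmulE (divs m)) //; apply: eq_bigr => k _.
rewrite (eq_bigr (fun l => \sum_(a <- divs m) \sum_(b <- divs m)
    (if mmul a b == l then f k * (g a * h b) else 0))); last first.
  move=> l /eqP klm; rewrite (@msmulE (divs m)); last first.
    move=> a; rewrite !in_fset_set ?inE; try exact: finite_divisor.
    by move=> [b abl]; exists (mmul b k); rewrite mulmA abl mulmC.
  rewrite big_distrr; apply: eq_bigr => a _.
  by rewrite big_distrr /= big_mkcond.
rewrite exchange_big; apply: eq_bigr => a _.
rewrite exchange_big; apply: eq_bigr => b _.
rewrite -big_mkcondr /=.
have [kabm|kabNm] := eqVneq; last first.
  apply: big1 => l /andP[/eqP klm /eqP abl].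
  by rewrite abl klm eqxx in kabNm.
rewrite big_mkcond (big_fsetD1 (mmul a b)) /=; last first.
  by have := mem_divsr k (mmul a b); rewrite kabm.
rewrite kabm !eqxx /= big_seq big1 ?addr0 // => l /fsetD1P[lab _].
by rewrite [mmul a b == l]eq_sym (negPf lab) andbF.
Qed.

Lemma msmulA : associative msmul.
Proof.
move=> f g h; apply: mseriesP => m; rewrite [RHS](_ : _ = msmul h (msmul f g) m).
  rewrite !msmul3 [RHS]exchange_big; apply: eq_bigr => k _ /=.
  rewrite [RHS]exchange_big; apply: eq_bigr => a _ /=; apply: eq_bigr => b _.
  by rewrite mulmA (mulmC _ b) mulrA (mulrC _ (h b)).
by rewrite msmulC.
Qed.

Lemma ms1_neq0 : msC 1 != 0 :> S.
Proof.
apply/eqP => /(congr1 (fun f : S => f mone)); rewrite /msC /= eqxx.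
by apply/eqP; rewrite oner_neq0.
Qed.

HB.instance Definition _ := GRing.Zmodule_isComNzRing.Build (mseries R V)
  msmulA msmulC msmul1 msmulDl ms1_neq0.

(* An element is a unit as soon as it has an inverse, which classical choice
   provides; by [ms_unit] this covers the series [1 - u], [u] without constant
   term, whose inverse is the geometric series. *)
Definition msunit : pred S := fun f => `[< exists g, g * f = 1 >].
Definition msinv f : S := xget f [set g | g * f = 1].

Lemma msmulV : {in msunit, left_inverse 1 msinv *%R}.
Proof. by move=> f /asboolP fU; apply: (@xgetPex _ f [set g | g * f = 1] fU). Qed.
Lemma msunitP f g : g * f = 1 -> msunit f.
Proof. by move=> gf; apply/asboolP; exists g. Qed.
Lemma msinv_out : {in [predC msunit], msinv =1 id}.
Proof.
by move=> f /asboolPn fN; apply: xgetPN => g gf; apply: fN; exists g.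
Qed.

HB.instance Definition _ := GRing.ComNzRing_hasMulInverse.Build (mseries R V)
  msmulV msunitP msinv_out.

Lemma mscoef_sum (I : Type) (r : seq I) (P : pred I) (F : I -> S) m :
  (\sum_(i <- r | P i) F i) m = \sum_(i <- r | P i) F i m.
Proof. by apply: (big_morph (fun f : S => f m)) => //=; rewrite if_same. Qed.

Lemma mscoefM f g m :
  (f * g) m = \sum_(k <- divs m) \sum_(l <- divs m | mmul k l == m) f k * g l.
Proof. exact: msmulE. Qed.

Lemma mscoefX_deg f i m : f mone = 0 -> (mdeg m < i)%N -> (f ^+ i) m = 0.
Proof.
move=> f1; elim: i m => // i IHi m mi; rewrite exprS mscoefM.
rewrite big1 // => k _; rewrite big1 // => l /eqP klm.
have [->|/eqP kN1] := eqVneq k mone; first by rewrite f1 mul0r.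
rewrite IHi ?mulr0 // -ltnS (leq_trans _ mi) // -klm mdegM ltnS.
by rewrite -[X in (X < _)%N]add0n ltn_add2r lt0n; apply/eqP => /mdeg_eq0I.
Qed.

Lemma ms_unit f : f mone = 1 -> f \is a GRing.unit.
Proof.
move=> f1; apply/asboolP.
pose h := 1 - f; pose G N := \sum_(i < N) h ^+ i.
have h1 : h mone = 0 by rewrite /h /= f1 eqxx subrr.
exists (MSeries (fun m => G (mdeg m).+1 m)); apply: mseriesP => m.
have GE k : (mdeg k <= mdeg m)%N -> G (mdeg k).+1 k = G (mdeg m).+1 k.
  move=> km; rewrite /G -!(big_mkord xpredT (fun i => h ^+ i)).
  rewrite [in RHS](big_cat_nat (n := (mdeg k).+1)) //=.
  rewrite [X in _ = _ + X]mscoef_sum [X in _ = _ + X]big_nat.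
  by rewrite [X in _ = _ + X]big1 ?addr0 // => i /andP[ki _]; exact: mscoefX_deg.
transitivity ((G (mdeg m).+1 * f) m).
  rewrite !mscoefM; apply: eq_bigr => k _; apply: eq_bigr => l /eqP klm.
  by rewrite -GE // -klm mdegM leq_addr.
have -> : G (mdeg m).+1 * f = 1 - h ^+ (mdeg m).+1.
  rewrite -opprB subrX1 -/(G _) mulrC -mulNr; congr (_ * _).
  by rewrite opprB /h opprB addrC subrK.
transitivity ((1 : S) m - (h ^+ (mdeg m).+1) m); first by [].
by rewrite mscoefX_deg ?subr0.
Qed.

End MSeries.

(* Coefficientwise sum of a possibly infinite summable family, i.e. one in
   which each monomial occurs in finitely many members. *)
Definition ms_sum (R : nzRingType) (V I : choiceType) (A : set I)
    (F : I -> mseries R V) : mseries R V :=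
  MSeries (fun m => \sum_(i \in A) F i m).

Variant letter := Lx of nat | Lalpha of nat | Lbeta of nat.

Definition code_letter (u : letter) : nat + (nat + nat) :=
  match u with
  | Lx k => inl k
  | Lalpha k => inr (inl k)
  | Lbeta k => inr (inr k)
  end.
Definition decode_letter (c : nat + (nat + nat)) : letter :=
  match c with
  | inl k => Lx k
  | inr (inl k) => Lalpha k
  | inr (inr k) => Lbeta k
  end.
Lemma code_letterK : cancel code_letter decode_letter.
Proof. by case. Qed.
HB.instance Definition _ := Equality.copy letter (can_type code_letterK).
HB.instance Definition _ := Choice.copy letter (can_type code_letterK).

(* The ring Z[[x, alpha, beta]] where both sides of the formula live. *)
Notation fseries := (mseries int letter).

Definition x_ (l : nat) : fseries := msX (Lx l).
Definition alpha_ (j : nat) : fseries := msX (Lalpha j).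
Definition beta_ (i : nat) : fseries := msX (Lbeta i).

(* Formal Z-linear combinations of letters are the elements of the free abelian
   group [{malg letter}]; [<< u >>] is the letter [u] and [Z@_u] the coefficient
   of [u] in [Z]. *)
Definition X_itv (r s : nat) : {malg letter} := \sum_(r <= l < s.+1) << Lx l >>.
Definition Apar (k : nat) : {malg letter} := \sum_(1 <= l < k.+1) << Lalpha l >>.
Definition Bpar (k : nat) : {malg letter} := \sum_(1 <= l < k.+1) << Lbeta l >>.

(* prod_u (1 + u t)^(c_u), a power series in the single variable [t = msX tt]
   with coefficients in [fseries]; [^] is exponentiation by an integer. *)
Definition e_gen (Z : {malg letter}) : mseries fseries unit :=
  \prod_(u <- msupp Z) (1 + msC (msX u) * msX tt) ^ (Z@_u).

(* e_m[Z]; e_m[Z] = 0 for m < 0 is never needed. *)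
Definition esym (m : nat) (Z : {malg letter}) : fseries :=
  e_gen Z (expcmn (ucm tt) m).

(* e_m[Y (-) W]: the terms of the sum are homogeneous of degree a + b. *)
Definition esym_ominus (m : int) (Y W : {malg letter}) : fseries :=
  ms_sum [set ab : nat * nat | ab.1%:Z - ab.2%:Z = m]
    (fun ab => esym ab.1 Y * esym ab.2 W).

(* 1-based access, used only for [1 <= i] *)
Definition at1 (v : seq nat) (i : nat) : nat := nth 0%N v i.-1.

Definition is_partition (la : seq nat) : bool := sorted geq la && (0%N \notin la).

Definition transpose (la : seq nat) : seq nat :=
  [seq count (fun p => k < p)%N la | k <- iota 0 (head 0%N la)].

Definition subpart (mu la : seq nat) : Prop :=
  forall i, (1 <= i)%N -> (at1 mu i <= at1 la i)%N.

(* The cells of nu/rho, as pairs (row, column), both counted from 1. *)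
Definition in_skew (nu rho : seq nat) (c : nat * nat) : bool :=
  (1 <= c.1)%N && (at1 rho c.1 < c.2 <= at1 nu c.1)%N.

(* A marked multiset {a_1 <= ... <= a_k} is the list of the pairs
   (a_t, "a_t is marked"). *)
Definition mmultiset := seq (nat * bool).

Definition wf_mmultiset (e : mmultiset) : bool :=
  [&& all (fun a => 0 < a.1)%N e,
      ~~ head false [seq a.2 | a <- e]
    & sorted (fun a b => if b.2 then a.1 < b.1 else a.1 <= b.1)%N e].

(* For nonempty [e], which is sorted by its first components. *)
Definition mmin (e : mmultiset) : nat := head 0%N [seq a.1 | a <- e].
Definition mmax (e : mmultiset) : nat := last 0%N [seq a.1 | a <- e].

Definition n_unmarked (e : mmultiset) : nat := count (fun a => ~~ a.2) e.
Definition n_marked (e : mmultiset) : nat := count (fun a => a.2) e.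

(* The filled cells are those with a nonempty multiset, i.e. the support. *)
Definition filling := {fsfun nat * nat -> mmultiset with [::]}.

Definition is_tableau (nu rho : seq nat) (T : filling) : Prop :=
  [/\ forall c, (c \in finsupp T) = in_skew nu rho c,
      forall c, c \in finsupp T -> wf_mmultiset (T c),
      forall i j, (i, j) \in finsupp T -> (i, j.+1) \in finsupp T ->
        (mmax (T (i, j)) <= mmin (T (i, j.+1)))%N
    & forall i j, (i, j) \in finsupp T -> (i.+1, j) \in finsupp T ->
        (mmax (T (i, j)) < mmin (T (i.+1, j)))%N].

Definition col_flagged (r s : seq nat) (T : filling) : Prop :=
  forall i j, (i, j) \in finsupp T ->
    (at1 r j <= mmin (T (i, j)))%N /\ (mmax (T (i, j)) <= at1 s j)%N.

Definition wt (T : filling) : fseries :=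
  \prod_(c <- finsupp T)
    ((\prod_(a <- T c) x_ a.1) * alpha_ c.2 ^+ (n_unmarked (T c)).-1
      * (- beta_ c.1) ^+ n_marked (T c)).

(* G^{col(r,s)}_{nu/rho}(x; alpha, beta).  The family is summable: the degree
   of [wt T] in the x variables is the total size of the multisets of [T]. *)
Definition G_col (r s : seq nat) (nu rho : seq nat) : fseries :=
  ms_sum [set T : filling | is_tableau nu rho T /\ col_flagged r s T] wt.

(* Main.v *)
(* Let x = x_{s_i}, a = alpha_i and b = beta_{lambda_i}.  In column i of a
   tableau the letter s_i can only occur in the bottom cell.  If that cell is a
   corner (lambda_{i+1} < lambda_i), removing one occurrence of s_i from it gives
     (1 - a x) G(lambda, s) = (1 - b x) G(lambda, s - e_i) + x G(lambda - e_i, s - e_i);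
   if lambda_{i+1} = lambda_i and s_i = s_{i+1} + 1, the letter does not occur at
   all and G(lambda, s) = G(lambda, s - e_i).  Since D(s - e_i) = (1 - a x) D(s),
   these match relations for row i of the determinant (in the second case modulo
   x times row i+1).  The flag condition guarantees that some column with
   mu_i < lambda_i is of one of these two kinds, so induction on the sum of the
   s_i reduces to lambda = mu, where the matrix is triangular, or to a column
   too long for its flags, where both sides vanish. *)
Require Import Defs.
From HB Require Import structures.
From mathcomp Require Import all_boot all_order all_algebra.
From mathcomp Require Import perm finmap.
From mathcomp Require Import boolp classical_sets functions cardinality fsbigop.
From mathcomp Require Import monalg.
From mathcomp Require Import zify ring.

Set Implicit Arguments.
Unset Strict Implicit.
Unset Printing Implicit Defensive.

Import Order.TTheory GRing.Theory Num.Theory.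
Local Open Scope ring_scope.

(** * Power series *)

Section SeriesCoefficients.
Context {R : comNzRingType} {V : choiceType}.
Implicit Types (f g : mseries R V) (m : {cmonom V}).

Lemma mscoefB f g m : (f - g) m = f m - g m.
Proof. by []. Qed.

Lemma mscoefCM c f m : (msC c * f) m = c * f m.
Proof.
rewrite mscoefM.
have := mem_divsl mone m; rewrite mul1m => oD.
have := mem_divsr mone m; rewrite mul1m => mD.
rewrite (big_fsetD1 mone) //= [X in _ + X]big_seq [X in _ + X]big1 => [|k].
  rewrite addr0 big_mkcond (big_fsetD1 m) //= mul1m !eqxx.
  rewrite [X in _ + X]big_seq big1 ?addr0 // => l /fsetD1P[/negPf lm _].
  by rewrite mul1m lm.
by case/fsetD1P => /negPf k1 _; apply: big1 => l _; rewrite k1 mul0r.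
Qed.

Lemma mscoefMX f v m : (f * msX v) (mmul m (ucm v)) = f m.
Proof.
rewrite mscoefM (exchange_big_dep xpredT) //=.
rewrite (big_fsetD1 (ucm v)) ?mem_divsr //= [X in _ + X]big_seq [X in _ + X]big1 => [|l].
  rewrite addr0 big_mkcond (big_fsetD1 m) ?mem_divsl //= !eqxx mulr1.
  rewrite [X in _ + X]big_seq big1 ?addr0 // => l /fsetD1P[/negPf lm _].
  case: eqP => // /(congr1 (fun p : {cmonom V} => divcm p (ucm v))) E.
  suff /eqP : l = m by rewrite lm.
  apply/eqP/cmP => i; move/(congr1 (fun p : {cmonom V} => p i)): E.
  by rewrite !divcmE !cmM !addnK.
by case/fsetD1P => /negPf k1 _; apply: big1 => k _; rewrite k1 mulr0.
Qed.

Lemma mscoefMX1 f v : (f * msX v) mone = 0.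
Proof.
rewrite mscoefM big1 // => k _; apply: big1 => l /eqP/mulcm_eq0[_ ->] /=.
by rewrite eq_sym (cm1_eq1 v) mulr0.
Qed.

(** A lower bound on the order of a series; on tableau weights it yields summability. *)
Definition low_degree (d : nat) f : Prop := forall m, (mdeg m < d)%N -> f m = 0.

Lemma low_degreeX v : low_degree 1 (msX v : mseries R V).
Proof.
by move=> m; rewrite /= ltnS leqn0 => /eqP m0; case: eqP m0 => // ->; rewrite mdegU.
Qed.

Lemma low_degreeM d e f g :
  low_degree d f -> low_degree e g -> low_degree (d + e) (f * g).
Proof.
move=> fd ge m mde; rewrite mscoefM big1 // => k _; apply: big1 => l /eqP klm.
have [kd|dk] := ltnP (mdeg k) d; first by rewrite fd ?mul0r.
rewrite ge ?mulr0 //; move: mde; rewrite -klm mdegM; lia.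
Qed.

Lemma low_degree_prod (I : Type) (t : seq I) (d : I -> nat) (F : I -> mseries R V) :
  (forall i, low_degree (d i) (F i)) ->
  low_degree (\sum_(i <- t) d i) (\prod_(i <- t) F i).
Proof.
by move=> dF; elim/big_ind2: _ => // d1 f1 d2 f2; exact: low_degreeM.
Qed.

End SeriesCoefficients.

(** * Sums of summable families *)

Section SeriesSums.
Local Open Scope classical_set_scope.
Context {R : comNzRingType} {V I : choiceType}.
Implicit Types (A B : set I) (F : I -> mseries R V).

(** A coefficient sum with infinite support would silently be 0; this predicate excludes that. *)
Definition summable A F : Prop :=
  forall m, finite_set (A `&` [set i | F i m <> 0]).

Lemma sub_summable A B F : B `<=` A -> summable A F -> summable B F.
Proof. by move=> BA sF m; apply: sub_finite_set (sF m) => i [/BA]. Qed.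

Lemma eq_ms_sum A F1 F2 : (forall i, A i -> F1 i = F2 i) ->
  ms_sum A F1 = ms_sum A F2.
Proof.
by move=> F12; apply: mseriesP => m; apply: eq_fsbigr => i /set_mem/F12 ->.
Qed.

Lemma ms_sum0 F : ms_sum set0 F = 0.
Proof. by apply: mseriesP => m; rewrite /= fsbig_set0 if_same. Qed.

Lemma ms_sumU A B F : summable (A `|` B) F -> (forall i, A i -> ~ B i) ->
  ms_sum (A `|` B) F = ms_sum A F + ms_sum B F.
Proof.
move=> sF AB; apply: mseriesP => m.
rewrite [LHS]/= fsbig_supp setIUl fsbigU0 -?fsbig_supp //.
- by apply: sub_finite_set (sF m) => i [Ai Fi]; split; first by left.
- by apply: sub_finite_set (sF m) => i [Ai Fi]; split; first by right.
- by move=> i [[/AB Bi _] [/Bi]].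
Qed.

Lemma ms_sum_image (J : choiceType) (D : set J) (h : J -> I) F : injective h ->
  ms_sum (h @` D) F = ms_sum D (F \o h).
Proof.
move=> hi; apply: mseriesP => m /=; rewrite fsbig_image //.
by move=> i j _ _; apply: hi.
Qed.

Lemma ms_sumZ (c : mseries R V) A F : summable A F ->
  ms_sum A (fun i => c * F i) = c * ms_sum A F.
Proof.
move=> sF; apply: mseriesP => m; rewrite mscoefM.
set D := fset_set _.
(* Only the coefficients of [F i] at divisors of [m] enter, and these divisors are finite in number,
   so one finite index set [B] serves for all of them. *)
pose B := \bigcup_(l in [set` D]) (A `&` [set i | F i l <> 0]).
have Bfin : finite_set B by apply: bigcup_finite => [|l _]; [exact: finite_fset|exact: sF].
have BA : B `<=` A by move=> i [l _ []].
have sB l : l \in D -> ms_sum A F l = \sum_(i <- fset_set B) F i l.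
  move=> lD; rewrite -fsbig_finite //= (fsbig_widen B A) // => i [Ai /= NBi].
  by apply: contrapT => Fi; apply: NBi; exists l.
transitivity (\sum_(i \in A) (c * F i) m); first by [].
rewrite -(fsbig_widen B A) //; last first.
  move=> i [Ai NBi]; rewrite /preimage mksetE mscoefM big_seq big1 // => k _.
  rewrite big_seq_cond big1 // => l /andP[lD _].
  by have [->|/eqP Fi] := eqVneq (F i l) 0; [rewrite mulr0|case: NBi; exists l].
rewrite fsbig_finite //.
under eq_bigr do rewrite mscoefM -/D.
rewrite exchange_big; apply: eq_bigr => k _.
rewrite exchange_big [RHS]big_seq_cond [LHS]big_seq_cond.
apply: eq_bigr => l /andP[lD _].
by rewrite sB // big_distrr.
Qed.

End SeriesSums.

(** * Elementary symmetric functions of formal differences *)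

Section ElementarySymmetric.
Implicit Types (Z W : {malg letter}) (u : letter) (L : seq letter).

Definition letters L : {malg letter} := \sum_(u <- L) << u >>.

Local Notation linear_factor u := (1 + msC (msX u) * msX tt : mseries fseries unit).

Lemma linear_factor_unit u : linear_factor u \is a GRing.unit.
Proof.
apply: ms_unit; rewrite -[LHS]/((1 : mseries fseries unit) mone + (msC (msX u) * msX tt) mone).
by rewrite mscoefMX1 addr0 /= eqxx.
Qed.

Lemma e_genEw (D : {fset letter}) Z : (msupp Z `<=` D)%fset ->
  e_gen Z = \prod_(u <- D) linear_factor u ^ Z@_u.
Proof.
move=> ZD; rewrite /e_gen (big_fset_incl _ ZD) // => u _ uNZ.
by rewrite mcoeff_outdom ?expr0z.
Qed.

(** Exponents of a common letter add; as they may be negative, each linear factor has to be a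
    unit. *)
Lemma e_genD Z W : e_gen (Z + W) = e_gen Z * e_gen W.
Proof.
pose D := (msupp Z `|` msupp W)%fset.
rewrite (@e_genEw D) ?msuppD_le // (@e_genEw D Z) ?fsubsetUl //.
rewrite (@e_genEw D W) ?fsubsetUr // -big_split; apply: eq_bigr => u _.
by rewrite mcoeffD exprzDr ?linear_factor_unit.
Qed.

Lemma e_gen0 : e_gen 0 = 1.
Proof. by rewrite /e_gen msupp0 big_seq_fset0. Qed.

Lemma e_genU u : e_gen << u >> = linear_factor u.
Proof. by rewrite /e_gen msuppU oner_eq0 big_seq_fset1 mcoeffUU expr1z. Qed.

Lemma expcmnSr m : expcmn (ucm tt) m.+1 = mmul (expcmn (ucm tt) m) (ucm tt).
Proof. by rewrite mulmC; case: m => //; rewrite [RHS](@mulm1 {cmonom unit}). Qed.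

(** Extending e_m by 0 to negative indices lets the recurrences hold without boundary cases. *)
Definition esymz (z : int) Z : fseries := if z is Posz m then Defs.esym m Z else 0.

Lemma esymz0 z : esymz z 0 = (z == 0)%:R.
Proof.
case: z => [m|m] //; rewrite /esymz /Defs.esym e_gen0; case: m => [|m].
  by rewrite [LHS]/= eqxx.
rewrite expcmnSr [LHS]/= ifN //; apply/eqP => /mulcm_eq0[_ /eqP].
by rewrite (cm1_eq1 tt).
Qed.

Lemma esymzDU z Z u : esymz z (Z + << u >>) = esymz z Z + msX u * esymz (z - 1) Z.
Proof.
have E m : Defs.esym m (Z + << u >>) =
    Defs.esym m Z + (e_gen Z * msC (msX u) * msX tt) (expcmn (ucm tt) m).
  by rewrite /Defs.esym e_genD e_genU mulrDr mulr1 mulrA.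
case: z => [m|m]; last by rewrite /= mulr0 addr0.
rewrite /esymz E; case: m => [|m]; first by rewrite mscoefMX1 mulr0.
by rewrite expcmnSr mscoefMX mulrC mscoefCM -addn1 PoszD addrK.
Qed.

Lemma letters_rcons L u : letters (rcons L u) = letters L + << u >>.
Proof. by rewrite /letters -cats1 big_cat big_seq1. Qed.

Lemma esymz_letters z L : (size L)%:Z < z -> esymz z (letters L) = 0.
Proof.
elim/last_ind: L z => [|L u IH] z; rewrite ?size_rcons => zL.
  by rewrite /letters big_nil esymz0; case: eqP zL => // ->.
by rewrite letters_rcons esymzDU !IH ?mulr0 ?addr0 //; lia.
Qed.

(** The terms with a > |L| vanish, so the infinite sum becomes a finite one over a, with b = a -
    m. *)
Lemma esym_ominusE N m L W : (size L < N)%N ->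
  esym_ominus m (letters L) W =
    \sum_(a < N) esymz a (letters L) * esymz (a%:Z - m) W.
Proof.
move=> LN; apply: mseriesP => k; rewrite mscoef_sum -(big_mkord xpredT
  (fun a => (esymz a (letters L) * esymz (a%:Z - m) W) k)) /=.
pose g a := (a, `|a%:Z - m|%N).
(* Indices a < m have no partner b in the left sum; on the right their factor [esymz (a - m)] is
   0. *)
pose t := [seq g a | a <- index_iota 0 N & m <= a%:Z].
rewrite (@fsbigE _ _ _ _ _ t); first last.
- move=> [a b] abm /negP abNt; have {}abm : a%:Z - b%:Z = m := abm.
  have aL : (N <= a)%N.
    rewrite leqNgt; apply/negP => aN; case: abNt; apply/mapP; exists a.
      by rewrite mem_filter mem_index_iota aN /=; lia.
    by rewrite /g; congr pair; lia.
  suff : (esymz a (letters L) * Defs.esym b W) k = 0 by [].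
  by rewrite esymz_letters ?mul0r /= ?if_same //; lia.
- move=> [a b] /mapP[c]; rewrite mem_filter => /andP[cm _] [-> ->] /=; lia.
- by rewrite map_inj_uniq ?filter_uniq ?iota_uniq // => a b [].
rewrite big_map big_filter_cond big_mkcond; apply: eq_bigr => a _.
have [ma|ma] := lerP m a.
  rewrite ifT; last by apply/mem_set => /=; lia.
  have -> : a%:Z - m = Posz `|a%:Z - m| by lia.
  by [].
have -> : esymz (a%:Z - m) W = 0 by case E: (a%:Z - m) => [z|z] //; lia.
by rewrite -[RHS]/((Defs.esym a (letters L) * 0) k) mulr0 /= if_same.
Qed.

Lemma esym_ominusDl m L W u :
  esym_ominus m (letters (rcons L u)) W =
    esym_ominus m (letters L) W + msX u * esym_ominus (m - 1) (letters L) W.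
Proof.
pose N := (size L).+1.
rewrite (@esym_ominusE N.+1) ?size_rcons // !(@esym_ominusE N) //.
rewrite letters_rcons; under eq_bigr do rewrite esymzDU mulrDl -mulrA.
rewrite big_split -mulr_sumr; congr (_ + _ * _).
  rewrite big_ord_recr [esymz (nat_of_ord ord_max) _]esymz_letters ?mul0r.
    by rewrite [LHS]addr0.
  by rewrite /=; lia.
rewrite big_ord_recl mul0r add0r; apply: eq_bigr => a _; rewrite lift0.
by have [-> ->] : a.+1%:Z - 1 = a%:Z /\ a.+1%:Z - m = a%:Z - (m - 1) by lia.
Qed.

(** The index goes up because a letter of [W] counts with degree -1. *)
Lemma esym_ominusDr m L W u :
  esym_ominus m (letters L) (W + << u >>) =
    esym_ominus m (letters L) W + msX u * esym_ominus (m + 1) (letters L) W.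
Proof.
rewrite !(@esym_ominusE (size L).+1) // mulr_sumr -big_split.
apply: eq_bigr => a _; rewrite esymzDU mulrDr mulrCA.
by have -> : a%:Z - m - 1 = a%:Z - (m + 1) by lia.
Qed.

Lemma esym_ominus_gt m L W : (size L)%:Z < m -> esym_ominus m (letters L) W = 0.
Proof.
move=> Lm; rewrite (@esym_ominusE (size L).+1) // big1 // => a _.
have -> : esymz (a%:Z - m) W = 0; last by rewrite mulr0.
by case E: (a%:Z - m) => [z|z] //; have := ltn_ord a; lia.
Qed.

Lemma esym_ominus_lt m L L' : m + (size L')%:Z < 0 ->
  esym_ominus m (letters L) (letters L') = 0.
Proof.
move=> mL'; rewrite (@esym_ominusE (size L).+1) // big1 // => a _.
by rewrite [X in _ * X]esymz_letters ?mulr0 //; lia.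
Qed.

(** These are the diagonal entries when lambda = mu. The induction on [L] meets the index -1; adding
    u to -u gives 0, and e_{-1}[L (-) 0] = 0 then expresses that term through e_0. *)
Lemma esym_ominus_diag L u :
  esym_ominus 0 (letters L) (- << u >>) = \prod_(v <- L) (1 - msX u * msX v).
Proof.
elim/last_ind: L => [|L v IH].
  rewrite big_nil (@esym_ominusE 1) // big_ord1 /letters big_nil esymz0 eqxx mul1r.
  have := esymzDU 0 (- << u >>) u; rewrite addNr esymz0 eqxx.
  rewrite [X in _ + _ * X](_ : _ = 0) // mulr0 addr0 => E.
  by rewrite subr0 -[RHS]/(true%:R) E.
have E : esym_ominus (- 1) (letters L) (- << u >>) =
    - (msX u * \prod_(v <- L) (1 - msX u * msX v)).
  apply/eqP; rewrite -addr_eq0 -IH -(addNr 1) -esym_ominusDr addNr; apply/eqP.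
  by have := @esym_ominus_lt (- 1) L [::]; rewrite {2}/letters big_nil; apply.
rewrite esym_ominusDl (_ : 0 - 1 = - 1) // E IH -cats1 big_cat big_seq1.
have step (A : comNzRingType) (P x y : A) : P + y * - (x * P) = P * (1 - x * y).
  by ring.
exact: step.
Qed.

End ElementarySymmetric.

(** * The determinant *)

Lemma AparS k : Apar k.+1 = Apar k + << Lalpha k.+1 >>.
Proof. by rewrite /Apar big_nat_recr. Qed.

Lemma BparS k : Bpar k.+1 = Bpar k + << Lbeta k.+1 >>.
Proof. by rewrite /Bpar big_nat_recr. Qed.

Lemma X_itvE a b : X_itv a b = letters [seq Lx l | l <- index_iota a b.+1].
Proof. by rewrite /letters big_map. Qed.

Lemma X_itv_nil a b : (b < a)%N -> X_itv a b = letters [::].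
Proof. by move=> ba; rewrite X_itvE /index_iota (eqP ba). Qed.

(** Here all coefficients are nonnegative: the combination consists of alpha_{j+1}, ..., alpha_{i-1}
    and beta_{a+1}, ..., beta_b, at least one letter too few to reach degree [m]. This makes the
    matrix block triangular. *)
Lemma esym_ominus_lower m L i j a b :
  (j < i)%N -> (a <= b)%N -> m <= a%:Z - b%:Z - i%:Z + j%:Z ->
  esym_ominus m (letters L) (Apar i.-1 - Apar j - Bpar a + Bpar b) = 0.
Proof.
case: i => // i; rewrite ltnS => ji ab mle.
have -> : Apar i.+1.-1 - Apar j - Bpar a + Bpar b =
    letters ([seq Lalpha l | l <- index_iota j.+1 i.+1] ++
             [seq Lbeta l | l <- index_iota a.+1 b.+1]).
  rewrite /letters big_cat !big_map /Apar /Bpar /=.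
  rewrite (big_cat_nat (n := j.+1) (p := i.+1)) //=.
  rewrite [\sum_(1 <= l < b.+1) _](big_cat_nat (n := a.+1)) //=.
  by rewrite [X in X - _ - _]addrC addrK -addrA addKr.
apply: esym_ominus_lt; rewrite size_cat !size_map !size_iota; lia.
Qed.

(** [0 < m] covers the empty interval, for which [b.+1 - a] may be negative. *)
Lemma esym_ominus_X_itv_gt m a b W :
  0 < m -> b.+1%:Z - a%:Z < m -> esym_ominus m (X_itv a b) W = 0.
Proof. by move=> m0 bam; rewrite X_itvE esym_ominus_gt // size_map size_iota; lia. Qed.

Lemma esym_ominus_X_itv_last m a b W :
    (a <= b.+1)%N \/ esym_ominus (m - 1) (letters [::]) W = 0 ->
  esym_ominus m (X_itv a b.+1) W =
    esym_ominus m (X_itv a b) W + x_ b.+1 * esym_ominus (m - 1) (X_itv a b) W.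
Proof.
have [ab _|ba [//|W0]] := leqP a b.+1.
  by rewrite !X_itvE /index_iota subSn // -addn1 iotaD subnKC // cats1 map_rcons esym_ominusDl.
by rewrite !X_itv_nil ?W0 ?mulr0 ?addr0 //; lia.
Qed.

(** Frobenius-Koenig: every permutation maps some row of [P] to a column outside [Q], so every term
    of the Leibniz sum has a zero factor. *)
Lemma det_zero_block (R : comPzRingType) n (A : 'M[R]_n) (P Q : {set 'I_n}) :
  (#|Q| < #|P|)%N -> (forall k j, k \in P -> j \notin Q -> A k j = 0) -> \det A = 0.
Proof.
move=> QP A0; apply: big1 => /= t _.
have [k kP tkNQ] : exists2 k, k \in P & t k \notin Q.
  apply/exists_inP; rewrite -negb_forall_in; apply: contraL QP => /forall_inP tPQ.
  rewrite -leqNgt -(card_imset _ (@perm_inj _ t)); apply/subset_leq_card/fintype.subsetP.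
  by move=> _ /imsetP[k kP ->]; apply: tPQ.
by rewrite (bigD1 k) //= A0 // mul0r mulr0.
Qed.

(** Partitions are handled as functions on [nat], with parts numbered from 1. Since [at1 l 0] is the
    first part again, monotonicity also holds at index 0. *)
Definition noninc_fun (f : nat -> nat) : Prop := forall j, (f j.+1 <= f j)%N.

Lemma noninc_fun_le f : noninc_fun f -> forall a b, (a <= b)%N -> (f b <= f a)%N.
Proof.
move=> fN a; elim=> [|b IH]; first by rewrite leqn0 => /eqP->.
by rewrite leq_eqVlt => /predU1P[->//|/IH]; apply: leq_trans.
Qed.

(** The subtractions of the theorem are moved across the inequalities to stay in [nat]. *)
Definition flag_cond (la mu r s : nat -> nat) : Prop :=
  forall i, (0 < i)%N -> (mu i < la i.+1)%N ->
    (r i + mu i.+1 <= r i.+1 + mu i)%N /\ (s i + la i.+1 <= (s i.+1 + la i).+1)%N.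

Definition dec_at (i : nat) (f : nat -> nat) : nat -> nat :=
  fun k => if k == i then (f k).-1 else f k.

Lemma dec_at_id i f : dec_at i f i = (f i).-1.
Proof. by rewrite /dec_at eqxx. Qed.

Lemma dec_at_neq i k f : k != i -> dec_at i f k = f k.
Proof. by rewrite /dec_at => /negPf->. Qed.

Section Determinant.
Variables (n : nat) (mu r : nat -> nat).
Implicit Types (la s : nat -> nat).
Hypothesis mu_noninc : noninc_fun mu.

Definition entry la s (i j : nat) : fseries :=
  esym_ominus ((la i)%:Z - (mu j)%:Z - i%:Z + j%:Z) (X_itv (r j) (s i))
    (Apar i.-1 - Apar j - Bpar (la i) + Bpar (mu j)).

Definition jt_matrix la s : 'M[fseries]_n := \matrix_(i, j) entry la s i.+1 j.+1.

(* The rows a..b lie in one block of the block triangular matrix; only within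
   such a range does [flag_cond] compare flags. *)
Definition linked la (a b : nat) : bool :=
  all (fun t => mu t < la t.+1)%N (index_iota a b).

Lemma linkedP la a b :
  reflect (forall t, (a <= t < b)%N -> (mu t < la t.+1)%N) (linked la a b).
Proof.
apply: (iffP allP) => H t; first by move=> tab; apply: H; rewrite mem_index_iota.
by rewrite mem_index_iota; apply: H.
Qed.

Lemma linked_r la s a b : flag_cond la mu r s -> (0 < a <= b)%N -> linked la a b ->
  (r a + mu b <= r b + mu a)%N.
Proof.
move=> fc /andP[a0]; elim: b => [|b IH]; first by lia.
rewrite leq_eqVlt => /predU1P[<- //|ab] /linkedP ln.
have [||+ _] := fc b; [lia|by apply: ln; lia|].
have /IH H : (a <= b)%N by lia.
have /H : linked la a b by apply/linkedP => t tab; apply: ln; lia.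
lia.
Qed.

(** The flag condition is summed over the steps from [a] to [b]; each step contributes one unit to
    [b - a]. *)
Lemma linked_s la s a b : flag_cond la mu r s -> (0 < a <= b)%N -> linked la a b ->
  (s a + la b <= s b + la a + (b - a))%N.
Proof.
move=> fc /andP[a0]; elim: b => [|b IH]; first by lia.
rewrite leq_eqVlt => /predU1P[<- //|ab] /linkedP ln; first by lia.
have [||_ +] := fc b; [lia|by apply: ln; lia|].
have /IH H : (a <= b)%N by lia.
have /H : linked la a b by apply/linkedP => t tab; apply: ln; lia.
lia.
Qed.

Section Rows.
Variables (la s : nat -> nat) (i : nat).
Hypotheses (r_gt0 : (0 < r i)%N) (fc : flag_cond la mu r s).
Hypotheses (i_gt0 : (0 < i)%N) (mu_la : (mu i < la i)%N).
(** [feas] says that la_i - mu_i strictly increasing entries fit between r_i and s_i. *)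
Hypotheses (la_noninc : noninc_fun la) (feas : (la i + r i <= (s i + mu i).+1)%N).

(* If [r j > s i], both alphabets are empty and the last term must vanish. *)
Lemma entry_last j : (0 < j)%N ->
  entry la s i j = entry la (dec_at i s) i j + x_ (s i) *
    esym_ominus ((la i)%:Z - (mu j)%:Z - i%:Z + j%:Z - 1) (X_itv (r j) (s i).-1)
      (Apar i.-1 - Apar j - Bpar (la i) + Bpar (mu j)).
Proof.
move=> j_gt0; have := r_gt0.
rewrite /entry dec_at_id; case E: (s i) => [|u] ri; first by lia.
apply: esym_ominus_X_itv_last; rewrite -E.
(* For j = i, [feas] gives r_i <= s_i. For i < j the correction term has positive degree and
   vanishes on an empty alphabet. For j < i, either la_i <= mu_j and its degree is too low, or rows
   j to i are linked and r_j <= s_i follows. *)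
have [->|[ij|ji]] : j = i \/ (i < j)%N \/ (j < i)%N by lia.
- by left; lia.
- right; apply: esym_ominus_gt => /=; have := noninc_fun_le mu_noninc (ltnW ij); lia.
have [lamu|mula] := leqP (la i) (mu j).
  by right; apply: (@esym_ominus_lower _ [::]) => //; lia.
left; have := @linked_r la s j i fc; rewrite j_gt0 ltnW // => /(_ isT).
have -> : linked la j i.
  apply/linkedP => t tji.
  have := noninc_fun_le mu_noninc (a := j) (b := t).
  have := noninc_fun_le la_noninc (a := t.+1) (b := i); lia.
by move=> /(_ isT); lia.
Qed.

(** Replacing la_i by la_i - 1 adds beta_{la_i} to the parameters and lowers the degree by 1, so
    [esym_ominusDr] eliminates the correction term of [entry_last]. *)
Lemma entry_generic j : (0 < j)%N ->
  entry la s i j = (1 - beta_ (la i) * x_ (s i)) * entry la (dec_at i s) i j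
    + x_ (s i) * entry (dec_at i la) (dec_at i s) i j.
Proof.
move=> j_gt0; rewrite entry_last // /entry !dec_at_id.
set m := (la i)%:Z - _ - _ + _; set W := Apar _ - _ - _ + _.
have -> : Apar i.-1 - Apar j - Bpar (la i).-1 + Bpar (mu j) = W + << Lbeta (la i) >>.
  rewrite /W; case E: (la i) mu_la => [//|l] _ /=.
  by rewrite BparS opprD addrA -!addrA [X in _ = _ + (_ + (_ + X))]addrCA !addrA subrK.
have -> : (la i).-1%:Z - (mu j)%:Z - i%:Z + j%:Z = m - 1 by rewrite /m; lia.
rewrite X_itvE esym_ominusDr subrK -X_itvE.
have step (A : comNzRingType) (P Q x b : A) :
    P + x * Q = (1 - b * x) * P + x * (Q + b * P) by ring.
exact: step.
Qed.

(** Row i+1 has the shortened alphabet of row i, the extra parameter alpha_i and degree one lower;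
    the elimination is that of [entry_generic]. *)
Lemma entry_boundary j : (0 < j)%N -> la i.+1 = la i -> s i = (s i.+1).+1 ->
  entry la s i j = (1 - alpha_ i * x_ (s i)) * entry la (dec_at i s) i j
    + x_ (s i) * entry la s i.+1 j.
Proof.
move=> j_gt0 laE sE; rewrite entry_last // /entry !dec_at_id laE.
set m := (la i)%:Z - _ - _ + _; set W := Apar i.-1 - _ - _ + _.
have -> : Apar i.+1.-1 - Apar j - Bpar (la i) + Bpar (mu j) = W + << Lalpha i >>.
  rewrite /W; case: (i) i_gt0 => [//|k] _ /=.
  by rewrite AparS -!addrA [<< _ >> + _]addrC !addrA.
have -> : (la i)%:Z - (mu j)%:Z - i.+1%:Z + j%:Z = m - 1 by rewrite /m; lia.
rewrite sE [_.+1.-1]/= X_itvE esym_ominusDr subrK -X_itvE -sE.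
have step (A : comNzRingType) (P Q x a : A) :
    P + x * Q = (1 - a * x) * P + x * (Q + a * P) by ring.
exact: step.
Qed.

End Rows.

Lemma entry_dec_neq la s i k j : k != i ->
  entry (dec_at i la) (dec_at i s) k j = entry la s k j /\
  entry la (dec_at i s) k j = entry la s k j.
Proof. by move=> ki; rewrite /entry !dec_at_neq. Qed.

Lemma eq_row' m (A B : 'M[fseries]_(m, n)) (i : 'I_m) :
  (forall k j, k != i -> A k j = B k j) -> row' i A = row' i B.
Proof. by move=> AB; apply/matrixP => k j; rewrite !mxE AB // eq_sym neq_lift. Qed.

Lemma det_generic la s (i0 : 'I_n) (i := i0.+1) :
    (0 < r i)%N -> flag_cond la mu r s -> noninc_fun la ->
    (mu i < la i)%N -> (la i + r i <= (s i + mu i).+1)%N ->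
  \det (jt_matrix la s) =
    (1 - beta_ (la i) * x_ (s i)) * \det (jt_matrix la (dec_at i s))
    + x_ (s i) * \det (jt_matrix (dec_at i la) (dec_at i s)).
Proof.
move=> r_gt0 fc laN mula feas; apply: (determinant_multilinear (i0 := i0)).
- by apply/rowP => j; rewrite !mxE; apply: entry_generic.
- apply: eq_row' => k j ki; rewrite !mxE.
  by have [_ ->] := @entry_dec_neq la s i k.+1 j.+1 ki.
apply: eq_row' => k j ki; rewrite !mxE.
by have [-> _] := @entry_dec_neq la s i k.+1 j.+1 ki.
Qed.

Lemma det_boundary la s (i0 : 'I_n) (i := i0.+1) :
    (0 < r i)%N -> flag_cond la mu r s -> noninc_fun la ->
    (mu i < la i)%N -> (la i + r i <= (s i + mu i).+1)%N ->
    (i < n)%N -> la i.+1 = la i -> s i = (s i.+1).+1 ->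
  \det (jt_matrix la s) =
    (1 - alpha_ i * x_ (s i)) * \det (jt_matrix la (dec_at i s)).
Proof.
move=> r_gt0 fc laN mula feas ilt laE sE.
(* [row i = (1 - alpha_i x) * reduced row i + x * row (i+1)] *)
pose C : 'M[fseries]_n := \matrix_(k, j)
  (if k == i0 then entry la s i.+1 j.+1 else entry la s k.+1 j.+1).
have C0 : \det C = 0.
  apply: (determinant_alternate (i1 := i0) (i2 := Ordinal ilt)).
    by rewrite -val_eqE /= /i; lia.
  by move=> j; rewrite !mxE eqxx -val_eqE /= /i ifN //; lia.
rewrite -[RHS]addr0 -[X in _ + X](mulr0 (x_ (s i))) -C0.
apply: (determinant_multilinear (i0 := i0)).
- by apply/rowP => j; rewrite !mxE eqxx; apply: entry_boundary.
- apply: eq_row' => k j ki; rewrite !mxE.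
  by have [_ ->] := @entry_dec_neq la s i k.+1 j.+1 ki.
by apply: eq_row' => k j ki; rewrite !mxE (negPf ki).
Qed.

(** Each t with la_{t+1} <= mu_t cuts the matrix into blocks, with zeros below the diagonal blocks.
    [P] has the rows of the block of i up to i itself, and all rows of later blocks; dropping i
    gives the columns [Q]. An entry with row in [P] and column outside [Q] either lies below a cut,
    or has row <= i <= column within the block of i, where its degree exceeds the size of its
    alphabet. *)
Lemma det_infeasible la s (i0 : 'I_n) (i := i0.+1) :
    flag_cond la mu r s -> noninc_fun la ->
    (mu i < la i)%N -> ((s i + mu i).+1 < la i + r i)%N ->
  \det (jt_matrix la s) = 0.
Proof.
move=> fc laN mula infeas.
pose P := [set k : 'I_n | if (k <= i0)%N then linked la k.+1 i else ~~ linked la i k.+1].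
have iP : i0 \in P by rewrite inE leqnn; apply/linkedP => t; rewrite /i; lia.
apply: (@det_zero_block _ _ _ P (P :\ i0)); first by rewrite [X in (_ < X)%N](cardsD1 i0) iP.
have lower (k j : 'I_n) t : (j < t <= k)%N -> (la t.+1 <= mu t)%N -> entry la s k.+1 j.+1 = 0.
  move=> jtk lamu; rewrite /entry X_itvE; apply: esym_ominus_lower; first by lia.
    have := noninc_fun_le mu_noninc (a := j.+1) (b := t).
    have := noninc_fun_le laN (a := t.+1) (b := k.+1); lia.
  by [].
have unlinked a b : ~~ linked la a b -> exists2 t, (a <= t < b)%N & (la t.+1 <= mu t)%N.
  by case/allPn => t; rewrite mem_index_iota -leqNgt => ab lamu; exists t.
move=> k j; rewrite mxE in_setD1 negb_and negbK !inE => kP jNQ.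
have {jNQ} : if (j < i0)%N then ~~ linked la j.+1 i else linked la i j.+1.
  case: (ltnP j i0) => ji.
    by move: jNQ; rewrite -val_eqE /= ltn_eqF // ltnW.
  have [->|jNi] := eqVneq j i0; first by apply/linkedP => t; rewrite /i; lia.
  move: jNQ; rewrite (negPf jNi) leqNgt ltn_neqAle ji andbT.
  by rewrite eq_sym (jNi : val j != val i0) /= negbK.
case: (ltnP j i0) => ji.
  case/unlinked => t tji lamu; apply: (lower k j t) => //.
  case: (leqP k i0) kP => [ki /linkedP lki|]; last by rewrite /i in tji; lia.
  by have := lki t; rewrite /i in tji *; lia.
move=> lij; case: (leqP k i0) kP => [ki lki|ki /unlinked[t tik lamu]]; last first.
  apply: (lower k j t) => //; have /linkedP /(_ t) := lij; lia.
(* The flag inequalities from row k to i and from column i to j carry the defect [infeas] over to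
   the entry (k, j). *)
have := linked_r fc _ lij; have := linked_s fc _ lki.
rewrite /i !ltnS /= => /(_ ki) s_le /(_ ji) r_le.
have := noninc_fun_le mu_noninc (a := i0.+1) (b := j.+1).
have := noninc_fun_le laN (a := k.+1) (b := i0.+1).
rewrite /i in mula infeas * => la_le mu_le.
by apply: esym_ominus_X_itv_gt; lia.
Qed.

Lemma det_base la s : (forall i, (0 < i)%N -> la i = mu i) ->
  \det (jt_matrix la s) =
    \prod_(i < n) \prod_(r i.+1 <= l < (s i.+1).+1) (1 - alpha_ i.+1 * x_ l).
Proof.
move=> lamu; rewrite -det_tr det_trig; last first.
  apply/is_trig_mxP => j k jk; rewrite !mxE /entry X_itvE lamu //.
  apply: esym_ominus_lower => //.
  by apply: noninc_fun_le => //; lia.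
apply: eq_bigr => k _; rewrite !mxE /entry lamu // subrr sub0r addNr X_itvE.
rewrite -addrA addNr addr0.
have -> : Apar k - Apar k.+1 = - << Lalpha k.+1 >>.
  by rewrite AparS opprD addrA subrr sub0r.
by rewrite esym_ominus_diag big_map.
Qed.

End Determinant.

(** * Tableaux *)

Section MarkedMultisets.
Implicit Types (e : mmultiset) (a : nat * bool).

Lemma mmax_rcons e a : mmax (rcons e a) = a.1.
Proof. by rewrite /mmax map_rcons last_rcons. Qed.

Lemma mmin_rcons e a : e != [::] -> mmin (rcons e a) = mmin e.
Proof. by case: e. Qed.

(** The recurrence adds and removes entries at the largest end of a multiset, hence [rcons]. *)
Lemma wf_rcons e a : e != [::] ->
  wf_mmultiset (rcons e a) =
    [&& wf_mmultiset e, (0 < a.1)%N & if a.2 then (mmax e < a.1)%N else (mmax e <= a.1)%N].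
Proof.
case: e => // b e _; rewrite /wf_mmultiset /mmax all_rcons /= rcons_path last_map.
by case: (0 < a.1)%N; case: (0 < b.1)%N; case: (all _ e); case: (b.2) => //=;
  rewrite ?andbF ?andbT.
Qed.

Lemma wf_mmultiset_le_mmax e a : wf_mmultiset e -> a \in e -> (a.1 <= mmax e)%N.
Proof.
elim/last_ind: e a => // e b IH a; rewrite mem_rcons mmax_rcons in_cons.
have [->|eN] := eqVneq e [::]; first by move=> _ /predU1P[->|].
rewrite wf_rcons // => /and3P[we _ eb] /predU1P[->//|/(IH _ we)].
by move/leq_trans; apply; case: ifP eb => // _ /ltnW.
Qed.

Lemma mmin_le_mmax e : wf_mmultiset e -> (mmin e <= mmax e)%N.
Proof. by case: e => // a e we; apply: (wf_mmultiset_le_mmax we); rewrite mem_head. Qed.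

Lemma n_unmarked_gt0 e : wf_mmultiset e -> e != [::] -> (0 < n_unmarked e)%N.
Proof. by case: e => // a e /and3P[_ /= aN _]; rewrite aN. Qed.

End MarkedMultisets.

Definition cell_wt (c : nat * nat) (e : mmultiset) : fseries :=
  (\prod_(a <- e) x_ a.1) * alpha_ c.2 ^+ (n_unmarked e).-1
    * (- beta_ c.1) ^+ n_marked e.

(* In a cell outside the shape this creates the multiset {t}. *)
Definition append_entry (c : nat * nat) (t : nat) (b : bool) (T : filling) : filling :=
  [fsfun T with c |-> rcons (T c) (t, b)].

Lemma mem_filling (T : filling) c : (c \in finsupp T) = (T c != [::]).
Proof. by rewrite mem_finsupp. Qed.

Lemma append_entry_inj c t b : injective (append_entry c t b).
Proof.
move=> T1 T2 /fsfunP E; apply/fsfunP => d.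
have := E d; rewrite /append_entry !fsfun_withE.
by have [->|//] := eqVneq d c; move/rcons_inj => [].
Qed.

(** An empty cell has weight 1, as the predecessor of 0 is 0, so fillings with different supports
    can be compared over one set of cells. *)
Lemma wtEw (D : {fset nat * nat}) (T : filling) : (finsupp T `<=` D)%fset ->
  wt T = \prod_(c <- D) cell_wt c (T c).
Proof.
move=> TD; rewrite /wt (big_fset_incl _ TD) // => c _ cNT.
by rewrite fsfun_dflt // big_nil !expr0 !mulr1.
Qed.

Lemma wt_with c e (T : filling) k :
  cell_wt c e = k * cell_wt c (T c) -> wt [fsfun T with c |-> e] = k * wt T.
Proof.
move=> ke; pose D := (c |` finsupp T)%fset.
have cD : c \in D by rewrite !inE eqxx.
rewrite (@wtEw D) ?(@wtEw D T) ?fsubsetU1 //; last first.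
  by rewrite finsupp_with; case: ifP => _; rewrite ?fsubsetU1 // fsubDset fsetUA fsetUid fsubsetU1.
rewrite (big_fsetD1 c) //= [in RHS](big_fsetD1 c) //= mulrA fsfun_with ke.
congr (_ * _); rewrite big_seq [RHS]big_seq; apply: eq_bigr => d.
by rewrite in_fsetD1 fsfun_withE => /andP[/negPf->].
Qed.

Lemma wt_append_new c t (T : filling) : T c = [::] ->
  wt (append_entry c t false T) = x_ t * wt T.
Proof.
move=> Tc; apply: wt_with; rewrite Tc /cell_wt big_nil big_seq1 /=.
by rewrite !expr0 !mulr1.
Qed.

Lemma wt_append_unmarked c t (T : filling) : wf_mmultiset (T c) -> T c != [::] ->
  wt (append_entry c t false T) = alpha_ c.2 * x_ t * wt T.
Proof.
move=> wT TcN; apply: wt_with; rewrite /cell_wt /n_unmarked /n_marked -!cats1 !count_cat.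
rewrite big_cat big_seq1 /= !addn0 addn1 -/(n_unmarked _).
rewrite -(prednK (n_unmarked_gt0 wT TcN)) exprS.
have step (A : comNzRingType) (P x a k l : A) : P * x * (a * k) * l = a * x * (P * k * l) by ring.
exact: step.
Qed.

Lemma wt_append_marked c t (T : filling) :
  wt (append_entry c t true T) = - beta_ c.1 * x_ t * wt T.
Proof.
apply: wt_with; rewrite /cell_wt /n_unmarked /n_marked -!cats1 !count_cat.
rewrite big_cat big_seq1 /= !addn0 addn1 exprS.
have step (A : comNzRingType) (P x a k l : A) : P * x * k * (a * l) = a * x * (P * k * l) by ring.
exact: step.
Qed.

Section Tableaux.
Variables (n : nat) (mu r : nat -> nat).
Implicit Types (la s : nat -> nat) (T : filling).

(** Column j of the conjugate shape consists of the rows mu_j + 1 to la_j, so no conjugate has to be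
    computed. *)
Definition in_shape la (c : nat * nat) : bool := (0 < c.2)%N && (mu c.2 < c.1 <= la c.2)%N.

Definition tableaux la s : set filling := fun T =>
  [/\ forall c, (c \in finsupp T) = in_shape la c,
      forall c, in_shape la c -> wf_mmultiset (T c),
      forall i j, in_shape la (i, j) -> in_shape la (i, j.+1) ->
        (mmax (T (i, j)) <= mmin (T (i, j.+1)))%N,
      forall i j, in_shape la (i, j) -> in_shape la (i.+1, j) ->
        (mmax (T (i, j)) < mmin (T (i.+1, j)))%N
    & forall i j, in_shape la (i, j) ->
        (r j <= mmin (T (i, j)))%N /\ (mmax (T (i, j)) <= s j)%N].

Definition tab_series la s : fseries := ms_sum (tableaux la s) wt.

Lemma tableaux_neq_nil la s T c : tableaux la s T -> in_shape la c -> T c != [::].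
Proof. by case=> supp _ _ _ _; rewrite -supp mem_finsupp. Qed.

(** Below row p there are la_j - p more cells, with strictly increasing entries of at most s_j. *)
Lemma tableaux_column_bound la s T p j : tableaux la s T -> in_shape la (p, j) ->
  (mmax (T (p, j)) + la j <= s j + p)%N.
Proof.
move=> [_ wfT _ colT flT] pj; have [d dE] : exists d, la j = (p + d)%N.
  by exists (la j - p)%N; rewrite subnKC //; case/and3P: pj.
elim: d => [|d IH] in p dE pj *.
  by have [_] := flT _ _ pj; lia.
have p1j : in_shape la (p.+1, j) by move: pj; rewrite /in_shape /=; lia.
have := IH p.+1; rewrite dE addSnnS => /(_ erefl p1j).
have := colT _ _ pj p1j; have := mmin_le_mmax (wfT _ p1j); lia.
Qed.

(** The column bound for the top cell of column i pushes its maximum below r_i. *)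
Lemma tableaux_infeasible la s i : (0 < i)%N -> (mu i < la i)%N ->
  ((s i + mu i).+1 < la i + r i)%N -> tableaux la s = set0.
Proof.
move=> i0 mula infeas; rewrite -subset0 => T tT.
have ci : in_shape la ((mu i).+1, i) by rewrite /in_shape /=; lia.
have := tableaux_column_bound tT ci; case: tT => _ /(_ _ ci)/mmin_le_mmax + _ _ /(_ _ _ ci)[+ _].
lia.
Qed.

(** All monomials of [wt T] have degree at least the total size of the multisets. So a monomial of
    degree d allows only multisets of at most d entries, bounded by the flags, in the finitely many
    cells of the shape. *)
Lemma summable_wt la s : noninc_fun la -> (forall j, (n < j)%N -> la j = 0%N) ->
  summable (tableaux la s) wt.
Proof.
move=> laN la0 m.
pose d := mdeg m; pose N := (\max_(j < n.+1) s j).+1.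
pose C : {fset nat * nat} := fset_set (`I_(la 0).+1 `*` `I_n.+1)%classic.
have inC c : in_shape la c -> c \in C.
  move=> /and3P[_ ml lc]; rewrite in_fset_set; last by apply: finite_setX; apply: finite_II.
  have := noninc_fun_le laN (leq0n c.2); rewrite inE /=; split=> /=; first by lia.
  by rewrite ltnS leqNgt; apply/negP => /la0 E; rewrite E in lc; lia.
pose dec (p : 'I_N * bool) : nat * bool := (val p.1, p.2).
(* Every such [T] is decoded from a function on the finite box [C] with values in a finite type of
   short sequences. *)
pose F (g : {ffun C -> d.-bseq ('I_N * bool)}) : filling :=
  [fsfun c : C => map dec (g c) | [::]].
apply: (@sub_finite_set _ _ (F @` setT)%classic); last exact/finite_image/finite_finset.
move=> T [tT] /= wTm.
have szT c : (size (T c) <= d)%N.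
  have [cT|cNT] := boolP (c \in finsupp T); last by rewrite fsfun_dflt.
  rewrite leqNgt; apply/negP => dT; case: wTm.
  have low : low_degree (\sum_(c <- finsupp T) size (T c)) (wt T).
    apply: low_degree_prod => c'; rewrite -[size _]addn0; apply: low_degreeM => //.
    rewrite -[size _]addn0; apply: low_degreeM => //.
    rewrite -sum1_size; apply: low_degree_prod => a; exact: low_degreeX.
  by apply: low; rewrite (big_fsetD1 c) //= (leq_trans dT) ?leq_addr.
pose enc (a : nat * bool) : 'I_N * bool := (inord a.1, a.2).
have szE c : (size (map enc (T c)) <= d)%N by rewrite size_map.
exists [ffun c => Bseq (szE (val c))] => //; apply/fsfunP => c.
rewrite /F fsfun_ffun; case: insubP => [u uC uE|cNC] /=; last first.
  by rewrite fsfun_dflt //; case: tT => -> _ _ _ _; apply: contra cNC; apply: inC.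
rewrite ffunE /= -uE -map_comp -[RHS]map_id; apply/eq_in_map => a aT.
have [supp wfT _ _ flT] := tT.
have cs : in_shape la (val u).
  by rewrite -supp mem_finsupp; apply: contraTneq aT => ->.
rewrite /dec /enc /= inordK; first by case: (a).
rewrite ltnS (leq_trans (wf_mmultiset_le_mmax (wfT _ cs) aT)) //.
move: (val u) cs => [p j] cs /=; have [_ /leq_trans] := flT _ _ cs; apply.
have jn : (j < n.+1)%N.
  by rewrite ltnS leqNgt; apply/negP => /la0 E; move: cs; rewrite /in_shape /= E; lia.
exact: (leq_bigmax (Ordinal jn)).
Qed.

(** * The largest letter at the bottom of a column *)

Section Corner.
Variables (la s : nat -> nat) (i : nat).
Hypotheses (r_gt0 : (0 < r i)%N) (i_gt0 : (0 < i)%N).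
Hypotheses (mu_la : (mu i < la i)%N) (feas : (la i + r i <= (s i + mu i).+1)%N).
Hypotheses (mu_noninc : noninc_fun mu) (la_noninc : noninc_fun la).

Local Notation c := (la i, i).
Local Notation la' := (dec_at i la).
Local Notation s' := (dec_at i s).

Lemma s_gt0_corner : (0 < s i)%N.
Proof. have := r_gt0; lia. Qed.

Lemma in_shape_corner : in_shape la c.
Proof. by rewrite /in_shape /=; lia. Qed.

Lemma in_shape_dec d : in_shape la' d = in_shape la d && (d != c).
Proof.
case: d => p j; rewrite /in_shape xpair_eqE /=.
have [->|ji] := eqVneq j i; last by rewrite dec_at_neq // andbF andbT.
by rewrite dec_at_id andbT; lia.
Qed.

(** Only the bottom cell can meet the old flag: a higher cell has a larger entry, at most s_i, below
    it. *)
Lemma tableaux_restrict T : tableaux la s T -> (mmax (T c) < s i)%N ->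
  tableaux la s' T.
Proof.
move=> [supp wfT rowT colT flT] Tc; split=> // p j pj.
have [rT sT] := flT _ _ pj; split=> //.
have [ji|ji] := eqVneq j i; last by rewrite dec_at_neq.
move: pj rT sT; rewrite {}ji dec_at_id => pi rT sT.
have [pE|pN] := eqVneq p (la i); first by rewrite pE; lia.
have p1i : in_shape la (p.+1, i) by move: pi; rewrite /in_shape /=; lia.
have := colT _ _ pi p1i; have := mmin_le_mmax (wfT _ p1i).
have [_] := flT _ _ p1i; lia.
Qed.

Lemma tableaux_relax T : tableaux la s' T -> tableaux la s T.
Proof.
move=> [supp wfT rowT colT flT]; split=> // p j pj.
have [rT sT] := flT _ _ pj; split=> //; apply: (leq_trans sT).
by rewrite /dec_at; case: ifP => // _; exact: leq_pred.
Qed.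

Lemma tableaux_remove T : tableaux la s T -> tableaux la' s' [fsfun T with c |-> [::]].
Proof.
move=> [supp wfT rowT colT flT]; set T' := [fsfun _ with _ |-> _].
have T'E d : in_shape la' d -> T' d = T d.
  by rewrite in_shape_dec fsfun_withE => /andP[_ /negPf->].
have sub d : in_shape la' d -> in_shape la d by rewrite in_shape_dec => /andP[].
split.
- move=> d; rewrite mem_filling fsfun_withE in_shape_dec.
  by case: (eqVneq d c) => _ /=; rewrite ?andbF ?andbT // -mem_filling supp.
- by move=> d dS; rewrite T'E //; apply/wfT/sub.
- by move=> p j S1 S2; rewrite !T'E //; apply: rowT; apply: sub.
- by move=> p j S1 S2; rewrite !T'E //; apply: colT; apply: sub.
move=> p j S1; rewrite T'E //; have [rT sT] := flT _ _ (sub _ S1); split=> //.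
have [ji|ji] := eqVneq j i; last by rewrite dec_at_neq.
move: S1 rT sT; rewrite {}ji dec_at_id => S1 rT sT.
have p1i : in_shape la (p.+1, i).
  by move: S1; rewrite /in_shape dec_at_id /=; lia.
have := colT _ _ (sub _ S1) p1i; have := mmin_le_mmax (wfT _ p1i).
have [_] := flT _ _ p1i; lia.
Qed.

Section Generic.
Hypothesis corner : (la i.+1 < la i)%N.

Lemma not_in_shape_right : in_shape la (la i, i.+1) = false.
Proof. by rewrite /in_shape /=; lia. Qed.

Lemma not_in_shape_below : in_shape la ((la i).+1, i) = false.
Proof. by rewrite /in_shape /=; lia. Qed.

(** A corner has no neighbour to the right or below, so the other cells see only the minimum of its
    multiset. *)
Lemma tableaux_set_corner T e : tableaux la s T -> e != [::] -> wf_mmultiset e ->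
    mmin e = mmin (T c) -> (mmax e <= s i)%N ->
  tableaux la s [fsfun T with c |-> e].
Proof.
move=> [supp wfT rowT colT flT] eN we min_e max_e; set T' := [fsfun _ with _ |-> _].
have minE d : mmin (T' d) = mmin (T d).
  by rewrite fsfun_withE; case: (eqVneq d c) => [->|].
have maxE d : d <> c -> mmax (T' d) = mmax (T d).
  by move=> /eqP/negPf dc; rewrite fsfun_withE dc.
split.
- move=> d; rewrite mem_filling fsfun_withE.
  by case: (eqVneq d c) => [->|_]; rewrite ?in_shape_corner ?eN // -mem_filling supp.
- by move=> d dS; rewrite fsfun_withE; case: (eqVneq d c) => // _; apply: wfT.
- move=> p j S1 S2; rewrite minE maxE ?rowT // => -[pE jE].
  by move: S2; rewrite pE jE not_in_shape_right.
- move=> p j S1 S2; rewrite minE maxE ?colT // => -[pE jE].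
  by move: S2; rewrite pE jE not_in_shape_below.
move=> p j S1; rewrite minE; have [rT sT] := flT _ _ S1; split=> //.
by rewrite fsfun_withE; case: (eqVneq (p, j) c) => // -[_ ->].
Qed.

(** If the cell to the left of the corner is in the shape, its entries are at most s_{i-1} -
    (la_{i-1} - la_i) by [tableaux_column_bound]; [left_flag] bounds this by s_i, so that {s_i} can
    be put in the corner. *)
Hypothesis left_flag :
  (0 < i.-1)%N -> (mu i.-1 < la i)%N -> (s i.-1 + la i <= s i + la i.-1)%N.

Lemma tableaux_add_corner T : tableaux la' s' T ->
  tableaux la s (append_entry c (s i) false T).
Proof.
move=> tT; have [supp wfT rowT colT flT] := tT.
have T0 : T c = [::].
  by apply: fsfun_dflt; rewrite supp in_shape_dec eqxx andbF.
rewrite /append_entry T0; set T' := [fsfun _ with _ |-> _].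
have T'c : T' c = [:: (s i, false)] by rewrite fsfun_with.
have s0 := s_gt0_corner.
have T'E d : d != c -> T' d = T d by rewrite fsfun_withE => /negPf->.
have new d : in_shape la d -> d != c -> in_shape la' d by rewrite in_shape_dec => -> ->.
split.
- move=> d; rewrite mem_filling; have [->|dc] := eqVneq d c.
    by rewrite T'c in_shape_corner.
  by rewrite T'E // -mem_filling supp in_shape_dec dc andbT.
- move=> d dS; have [->|dc] := eqVneq d c; last by rewrite T'E //; apply/wfT/new.
  by rewrite T'c /wf_mmultiset /= s0.
- move=> p j S1 S2; have [E|N1] := eqVneq (p, j) c.
    by move: E S2 => [-> ->]; rewrite not_in_shape_right.
  have [[pE jE]|N2] := eqVneq (p, j.+1) c; last by rewrite !T'E // rowT // new.
  rewrite T'E // pE jE T'c /mmin /=.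
  have jE' : j = i.-1 by rewrite -jE.
  have S1' := new _ S1 N1; have := tableaux_column_bound tT S1'.
  rewrite !dec_at_neq; [|by apply/eqP; lia..].
  have j0 : (0 < j)%N by case/and3P: S1.
  have := left_flag; rewrite -jE' => /(_ j0); move: S1; rewrite /in_shape /= pE; lia.
- move=> p j S1 S2; have [E|N1] := eqVneq (p, j) c.
    by move: E S2 => [-> ->]; rewrite not_in_shape_below.
  have [[pE jE]|N2] := eqVneq (p.+1, j) c; last by rewrite !T'E // colT // new.
  rewrite T'E // pE jE T'c /mmin /=.
  by have [_] := flT _ _ (new _ S1 N1); rewrite jE dec_at_id; lia.
move=> p j S1; have [[pE jE]|N1] := eqVneq (p, j) c.
  by rewrite pE jE T'c /mmin /mmax /=; lia.
have [rT sT] := flT _ _ (new _ S1 N1); rewrite T'E //; split=> //.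
by apply: (leq_trans sT); rewrite /dec_at; case: ifP => // _; exact: leq_pred.
Qed.

(** A marked s_i must exceed all entries already in the corner, hence the lowered flag in that
    case. *)
Lemma tableaux_append T b : tableaux la (if b then s' else s) T ->
  tableaux la s (append_entry c (s i) b T).
Proof.
move=> tT; have tT' : tableaux la s T by case: b tT => //; exact: tableaux_relax.
have TcN := tableaux_neq_nil tT' in_shape_corner.
have s0 := s_gt0_corner.
have [_ wfT _ _ flT] := tT; have [_ Tc] := flT _ _ in_shape_corner.
apply: tableaux_set_corner; rewrite ?mmin_rcons ?mmax_rcons //; first by case: (T c).
rewrite wf_rcons // wfT ?in_shape_corner // s0 /=.
by case: b tT Tc {flT} => _ Tc; rewrite ?dec_at_id in Tc; lia.
Qed.

(** If s_i occurs in the corner, take away its last copy. An unmarked copy leaves either a tableau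
    for [s] or an empty corner; a marked one leaves only smaller entries in the corner. *)
Lemma tableaux_split :
  tableaux la s = (tableaux la s' `|`
    ((append_entry c (s i) false @` (tableaux la s `|` tableaux la' s')) `|`
     (append_entry c (s i) true @` tableaux la s')))%classic.
Proof.
apply/seteqP; split=> [T tT|T]; last first.
  case=> [|[[T' [|] tT' <-]|[T' tT' <-]]].
  - exact: tableaux_relax.
  - exact: tableaux_append.
  - exact: tableaux_add_corner.
  - exact: tableaux_append.
have [lt|ge] := ltnP (mmax (T c)) (s i); first by left; apply: tableaux_restrict.
right; have [_ wfT _ _ flT] := tT; have [rc sc] := flT _ _ in_shape_corner.
have := wfT _ in_shape_corner; have := tableaux_neq_nil tT in_shape_corner.
case/lastP E: (T c) rc sc ge => [//|e [t b]]; rewrite mmax_rcons /= => rc sc ge _.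
have {sc ge}tE : t = s i by lia.
rewrite {}tE in E rc *.
pose T' : filling := [fsfun T with c |-> e].
have T'K : append_entry c (s i) b T' = T.
  apply/fsfunP => d; rewrite /append_entry !fsfun_withE eqxx.
  by case: (eqVneq d c) => [->|].
have [e0|eN] := eqVneq e [::].
  (* The first entry of a multiset is unmarked, so a lone s_i has [b = false]. *)
  rewrite /wf_mmultiset e0 => /and3P[_ /= bF _]; left; exists T'.
    by right; rewrite /T' e0; apply: tableaux_remove.
  by rewrite -(negPf bF).
rewrite wf_rcons // => /and3P[we _ be].
have tT' : tableaux la s T'.
  apply: tableaux_set_corner => //; first by rewrite E mmin_rcons.
  by case: b be {rc E T'K} => //= /ltnW.
case: b E be T'K {rc} => E be T'K; [right|left]; exists T' => //; last by left.
by apply: tableaux_restrict => //; rewrite fsfun_with.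
Qed.

Lemma tab_series_generic : (forall j, (n < j)%N -> la j = 0%N) ->
  (1 - alpha_ i * x_ (s i)) * tab_series la s =
    (1 - beta_ (la i) * x_ (s i)) * tab_series la s' + x_ (s i) * tab_series la' s'.
Proof.
move=> la0; have sm := summable_wt s la_noninc la0.
have la'0 j : (n < j)%N -> la' j = 0%N by move=> /la0 E; rewrite /dec_at E if_same.
have la'N : noninc_fun la'.
  move=> j; rewrite /dec_at; have := la_noninc j.
  by case: (j =P i) => [->|_]; case: (_ =P i) => _; have := corner; lia.
have sm' := summable_wt s' la_noninc la0.
have sm'' := summable_wt s' la'N la'0.
pose f := append_entry c (s i) false; pose g := append_entry c (s i) true.
have fA : ms_sum (f @` tableaux la s)%classic wt =
    alpha_ i * x_ (s i) * tab_series la s.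
  rewrite ms_sum_image; last exact: append_entry_inj.
  rewrite -ms_sumZ //; apply: eq_ms_sum => T tT; apply: wt_append_unmarked.
    by case: tT => _ wfT _ _ _; apply/wfT/in_shape_corner.
  exact: tableaux_neq_nil tT in_shape_corner.
have fC : ms_sum (f @` tableaux la' s')%classic wt = x_ (s i) * tab_series la' s'.
  rewrite ms_sum_image; last exact: append_entry_inj.
  rewrite -ms_sumZ //; apply: eq_ms_sum => T [supp _ _ _ _]; apply: wt_append_new.
  by apply: fsfun_dflt; rewrite supp in_shape_dec eqxx andbF.
have gB : ms_sum (g @` tableaux la s')%classic wt =
    - beta_ (la i) * x_ (s i) * tab_series la s'.
  rewrite ms_sum_image; last exact: append_entry_inj.
  by rewrite -ms_sumZ //; apply: eq_ms_sum => T _; apply: wt_append_marked.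
have fc b (T : filling) : append_entry c (s i) b T c = rcons (T c) (s i, b).
  by rewrite fsfun_with.
have NB b (T : filling) : ~ tableaux la s' (append_entry c (s i) b T).
  move=> [_ _ _ _ /(_ _ _ in_shape_corner)[_]].
  by rewrite fc mmax_rcons dec_at_id /=; have := s_gt0_corner; lia.
have split_A := tableaux_split; rewrite image_setU -/f -/g in split_A.
have {}sm : summable (tableaux la s' `|` (f @` tableaux la s `|`
    f @` tableaux la' s' `|` g @` tableaux la s'))%classic wt by rewrite -split_A.
have E : tab_series la s = tab_series la s' + (alpha_ i * x_ (s i) * tab_series la s
    + x_ (s i) * tab_series la' s' + - beta_ (la i) * x_ (s i) * tab_series la s').
  rewrite -fA -fC -gB {1}/tab_series {1}split_A.
  have sm1 := sub_summable (@subsetUr _ _ _) sm.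
  have sm2 := sub_summable (@subsetUl _ _ _) sm1.
  (* The pieces are disjoint: the first has no s_i in the corner, the mark tells [f] from [g], and
     the two images under [f] differ in whether the corner was empty before. *)
  rewrite !ms_sumU //.
  - move=> _ [T1 tT1 <-] [T2 tT2] /append_entry_inj ET.
    have := tableaux_neq_nil tT1 in_shape_corner; rewrite -ET => /eqP; apply.
    by apply: fsfun_dflt; case: tT2 => -> _ _ _ _; rewrite in_shape_dec eqxx andbF.
  - move=> T fT [T2 _ /fsfunP/(_ c)]; rewrite fc => gT.
    have [T1] : exists T1, f T1 = T by case: fT => -[T1 _ <-]; exists T1.
    by move=> /fsfunP/(_ c); rewrite fc -gT => /rcons_inj[].
  move=> T tT [[[T1 _ fT]|[T1 _ fT]]|[T1 _ gT]].
  - by apply: (NB false T1); rewrite -/f fT.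
  - by apply: (NB false T1); rewrite -/f fT.
  by apply: (NB true T1); rewrite -/g gT.
have step (A : comNzRingType) (G G1 G2 ax b x : A) :
    G = G1 + (ax * G + x * G2 + - b * x * G1) ->
  (1 - ax) * G = (1 - b * x) * G1 + x * G2.
  by move=> GE; rewrite mulrBl mul1r {1}GE; ring.
exact: step.
Qed.

End Generic.

(** The corner has the right neighbour (la_i, i+1), whose entries are at most s_{i+1}; weak increase
    along the row keeps s_i out of the corner. *)
Lemma tab_series_boundary : la i.+1 = la i -> s i = (s i.+1).+1 ->
  tab_series la s = tab_series la s'.
Proof.
move=> laE sE; rewrite /tab_series; congr ms_sum; apply/seteqP.
split=> T; last exact: tableaux_relax.
move=> tT; apply: tableaux_restrict => //; have [_ wfT rowT _ flT] := tT.
have ri : in_shape la (la i, i.+1) by have := mu_noninc i; rewrite /in_shape /=; lia.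
have := rowT _ _ in_shape_corner ri; have [_] := flT _ _ ri.
have := mmin_le_mmax (wfT _ ri); lia.
Qed.

End Corner.

End Tableaux.

(** * Induction on the flags *)

Lemma alpha_factor_unit i l : 1 - alpha_ i * x_ l \is a GRing.unit.
Proof.
apply: ms_unit; rewrite mscoefB /x_ mscoefMX1 subr0 /= eqxx.
by [].
Qed.

Section Induction.
Variables (n : nat) (mu r : nat -> nat).
Hypotheses (mu_noninc : noninc_fun mu) (r_gt0 : forall i, (0 < i <= n)%N -> (0 < r i)%N).
Implicit Types (la s : nat -> nat).

Definition flag_prod s : fseries :=
  \prod_(i < n) \prod_(r i.+1 <= l < (s i.+1).+1) (1 - alpha_ i.+1 * x_ l)^-1.

Lemma flag_prod_dec s (i0 : 'I_n) (i := i0.+1) : (0 < s i)%N -> (r i <= s i)%N ->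
  flag_prod (dec_at i s) = flag_prod s * (1 - alpha_ i * x_ (s i)).
Proof.
move=> s0 rs; rewrite /flag_prod (bigD1 i0) //= [in RHS](bigD1 i0) //=.
rewrite dec_at_id prednK // (big_nat_recr (s i)) //=.
rewrite (eq_bigr (fun k : 'I_n =>
  \prod_(r k.+1 <= l < (s k.+1).+1) (1 - alpha_ k.+1 * x_ l)^-1)); last first.
  by move=> k ki; rewrite dec_at_neq // eqSS.
have := divrr (alpha_factor_unit i (s i)).
have step (A : comNzRingType) (P Q v u : A) : u * v = 1 -> P * Q = P * v * Q * u.
  by move=> uv; transitivity (P * Q * (u * v)); [rewrite uv mulr1|ring].
exact: step.
Qed.

(** The only tableau is the empty filling, of weight 1, and D cancels the determinant. *)
Lemma tab_series_base la s : (forall i, (0 < i)%N -> la i = mu i) ->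
  tab_series mu r la s = flag_prod s * \det (jt_matrix n mu r la s).
Proof.
move=> lamu; rewrite det_base // /flag_prod -big_split.
rewrite [RHS]big1; last first.
  move=> i _; rewrite -big_split big1 //= => l _; exact/mulVr/alpha_factor_unit.
have noS c : in_shape mu la c = false.
  by rewrite /in_shape; have := lamu c.2; lia.
have -> : tab_series mu r la s = ms_sum [set [fsfun] : filling]%classic wt.
  congr ms_sum; apply/seteqP; split=> T.
    by case=> supp _ _ _ _; apply/fsfunP => c; rewrite fsfun0E fsfun_dflt // supp noS.
  by move=> ->; split=> [c|c|i j|i j|i j]; rewrite noS // in_finsupp0.
apply: mseriesP => m; rewrite /= fsbig_set1.
by rewrite (@wtEw fset0) ?finsupp0 // big_seq_fset0.
Qed.

(** The third conclusion is [left_flag], secured by taking the smallest candidate; the last one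
    separates the generic recurrence from the boundary one. *)
Lemma reducible_column la s : noninc_fun la -> (forall j, (n < j)%N -> la j = 0%N) ->
    flag_cond la mu r s -> (exists2 j, (0 < j)%N & (mu j < la j)%N) ->
  exists i, [/\ (0 < i <= n)%N, (mu i < la i)%N,
    (0 < i.-1)%N -> (mu i.-1 < la i)%N -> (s i.-1 + la i <= s i + la i.-1)%N &
    (la i.+1 < la i)%N \/ [/\ (i < n)%N, la i.+1 = la i & s i = (s i.+1).+1]].
Proof.
move=> laN la0 fc [j j0 muj].
pose right_ok i := (la i.+1 < la i)%N ||
  [&& (mu i < la i.+1)%N, la i.+1 == la i & s i == (s i.+1).+1].
pose P i := [&& (0 < i)%N, (mu i < la i)%N & right_ok i].
have le_n i : (0 < la i)%N -> (i <= n)%N.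
  by move=> lai; rewrite leqNgt; apply/negP => /la0; lia.
(* The last column with mu_i < la_i qualifies: la_{i+1} <= mu_{i+1} <= mu_i < la_i. *)
have exP : exists i, P i.
  have bnd i : (0 < i)%N && (mu i < la i)%N -> (i <= n)%N by move=> ?; apply: le_n; lia.
  have exQ : exists i, (0 < i)%N && (mu i < la i)%N by exists j; rewrite j0.
  case: (ex_maxnP exQ bnd) => i Qi maxi; exists i; rewrite /P /right_ok.
  have := maxi i.+1; have := mu_noninc i; have := laN i; lia.
(* If the flag condition on the left of [i] were tight, [i.-1] would satisfy [P] too. *)
case: (ex_minnP exP) => i /and3P[i0 mui ok] mini; exists i; split=> //.
- by rewrite i0 le_n //; lia.
- move=> i1 mui1; case: leqP => // lt.
  have := mini i.-1; have := fc _ i1; rewrite prednK // => /(_ mui1)[_ sle].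
  have := laN i.-1; have := mu_noninc i.-1; rewrite prednK // => mule lale.
  by rewrite /P /right_ok prednK //; lia.
case/orP: ok => [|/and3P[mui1 /eqP laE /eqP sE]]; [by left|right; split=> //].
by apply: le_n; lia.
Qed.

Lemma tab_series_det la s : noninc_fun la -> (forall j, (n < j)%N -> la j = 0%N) ->
    (forall j, (0 < j)%N -> (mu j <= la j)%N) -> flag_cond la mu r s ->
  tab_series mu r la s = flag_prod s * \det (jt_matrix n mu r la s).
Proof.
have [N] := ubnP (\sum_(j < n) s j.+1); elim: N => // N IH in la s *.
rewrite ltnS => sN laN la0 mula fc.
have [[j j0 muj]|no] := pselect (exists2 j, (0 < j)%N & (mu j < la j)%N); last first.
  apply: tab_series_base => i i0; apply/eqP; rewrite eqn_leq mula // andbT leqNgt.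
  by apply/negP => mui; apply: no; exists i.
have [[|k] [/andP[i0 iln] mui left_i right_i]] : exists i, _ :=
  reducible_column laN la0 fc (ex_intro2 _ _ j j0 muj); first by [].
set i := k.+1 in i0 iln mui left_i right_i *; pose i' : 'I_n := Ordinal iln.
have ri : (0 < r i)%N by rewrite r_gt0 ?i0.
have [feas|infeas] := leqP (la i + r i) (s i + mu i).+1; last first.
  rewrite /tab_series (tableaux_infeasible i0 mui infeas) ms_sum0.
  by rewrite (@det_infeasible n mu r mu_noninc la s i' fc laN mui infeas) mulr0.
have s0 : (0 < s i)%N by lia.
have rs : (r i <= s i)%N by lia.
pose s' := dec_at i s; pose la' := dec_at i la.
have s'N : (\sum_(j < n) s' j.+1 < N)%N.
  apply: leq_trans sN; rewrite (bigD1 i') //= [X in (_ < X)%N](bigD1 i') //=.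
  rewrite /s' dec_at_id -[X in (_ < X + _)%N](prednK s0) ltnS leq_add2l.
  by apply: leq_sum => l li; rewrite dec_at_neq // eqSS.
have PE : flag_prod s' = flag_prod s * (1 - alpha_ i * x_ (s i)).
  exact: (@flag_prod_dec s i' s0 rs).
have IHs : tab_series mu r la s' = flag_prod s' * \det (jt_matrix n mu r la s').
  apply: IH => // l l0 mul; have [rl sl] := fc l l0 mul; split=> //.
  rewrite /s' /dec_at; case: eqP => [lE|_]; case: eqP => [lE'|_]; try lia.
  (* Only the inequality at l = i - 1 gets harder when s_i drops, and [left_i] supplies it. *)
  have := left_i; rewrite -lE' /= in mul sl *; lia.
case: right_i => [corner|[ilt laE sE]]; last first.
  have dE := @det_boundary n mu r mu_noninc la s i' ri fc laN mui feas ilt laE sE.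
  have tE : tab_series mu r la s = tab_series mu r la s'.
    exact: tab_series_boundary.
  by rewrite tE IHs PE dE -mulrA.
have IHla : tab_series mu r la' s' = flag_prod s' * \det (jt_matrix n mu r la' s').
  apply: IH => // [l|l /la0 E|l l0|l l0]; rewrite /la' /s' /dec_at.
  - by have := laN l; case: (l =P i) => [->|_]; case: (_ =P i) => _; lia.
  - by rewrite E if_same.
  - by have := mula _ l0; case: (l =P i) => [->|_]; lia.
  move=> mul; have {mul} mul : (mu l < la l.+1)%N by move: mul; case: ifP => _; lia.
  (* s_i and la_i are positive and drop together, so s_i - la_i is unchanged and the flag condition
     persists. *)
  have [rl sl] := fc _ l0 mul; split=> //; move: sl.
  by case: (l =P i) => [->|_]; case: (_ =P i) => [->|_]; lia.
have dE := @det_generic n mu r mu_noninc la s i' ri fc laN mui feas.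
have tE := tab_series_generic ri i0 mui feas laN corner left_i la0.
(* The recurrence gives the tableau series only up to the unit 1 - alpha_i x_{s_i}; D(s') carries
   the same factor. *)
apply: (mulrI (alpha_factor_unit i (s i))).
have step (A : comNzRingType) (P u b x d1 d2 : A) :
    b * (P * u * d1) + x * (P * u * d2) = u * (P * (b * d1 + x * d2)) by ring.
by rewrite tE IHs IHla PE dE; apply: step.
Qed.

End Induction.

(** * Conjugate partitions and the passage from lists to functions *)

Lemma count_geq_sorted l j p : sorted geq l -> (0 < p)%N ->
  (j < count (leq p) l)%N = (p <= nth 0%N l j)%N.
Proof.
move=> + p0; elim: l j => [|x l IH] j /=; first by rewrite nth_nil; lia.
rewrite path_sortedE; last by move=> a b c; rewrite /geq /=; lia.
case/andP => /allP xl /IH{}IH; case: (leqP p x) => px.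
  by case: j => //= j; rewrite add1n ltnS IH.
have -> : count (leq p) l = 0%N.
  by apply/eqP; rewrite eqn0Ngt -has_count; apply/hasPn => y /xl; rewrite /geq /=; lia.
case: j => [|j] /=; first by lia.
have [jl|lj] := ltnP j (size l); last by rewrite nth_default; lia.
by have := xl _ (mem_nth 0%N jl); rewrite /geq /=; lia.
Qed.

Lemma at1_transpose l p : sorted geq l -> (0 < p)%N ->
  at1 (transpose l) p = count (leq p) l.
Proof.
case: p => // p sl _; rewrite /at1 /transpose /=.
have [pl|lp] := ltnP p (head 0%N l).
  by rewrite (nth_map 0%N) ?size_iota // nth_iota.
(* Past the first part of [l] the conjugate list has ended, and its default 0 agrees with the
   count. *)
rewrite nth_default ?size_map ?size_iota //; apply/eqP; rewrite eq_sym -leqn0 leqNgt.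
by rewrite count_geq_sorted // nth0; lia.
Qed.

(** Conjugation satisfies j <= la'_p iff p <= la_j, which is [count_geq_sorted] with j shifted by
    one. *)
Lemma in_skew_transpose la mu c : sorted geq la -> sorted geq mu ->
  in_skew (transpose la) (transpose mu) c = in_shape (at1 mu) (at1 la) c.
Proof.
case: c => [[|p] [|j]] sla smu; rewrite /in_skew /in_shape //= ?at1_transpose //.
by rewrite ltnNge !count_geq_sorted // -ltnNge.
Qed.

Lemma at1_noninc l : sorted geq l -> noninc_fun (at1 l).
Proof.
move=> /(sortedP 0%N) sl [|j] //=; rewrite /at1 /=.
have [|lj] := ltnP j.+1 (size l); first exact: sl.
by rewrite nth_default.
Qed.

Theorem theorem6p7 (n : nat) (la mu : seq nat) (r s : n.-tuple nat)
    (la_part : is_partition la) (la_n : (size la <= n)%N)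
    (mu_part : is_partition mu) (mu_n : (size mu <= n)%N)
    (mu_la : subpart mu la)
    (r_gt0 : forall i, (1 <= i <= n)%N -> (0 < at1 r i)%N)
    (s_gt0 : forall i, (1 <= i <= n)%N -> (0 < at1 s i)%N)
    (rs_cond : forall i, (1 <= i < n)%N -> (at1 mu i < at1 la i.+1)%N ->
       ((at1 r i)%:Z - (at1 mu i)%:Z
          <= (at1 r i.+1)%:Z - (at1 mu i.+1)%:Z :> int)
       /\ ((at1 s i)%:Z - (at1 la i)%:Z
          <= (at1 s i.+1)%:Z - (at1 la i.+1)%:Z + 1 :> int)) :
  G_col r s (transpose la) (transpose mu) =
    (\prod_(1 <= i < n.+1) \prod_(at1 r i <= l < (at1 s i).+1)
       (1 - alpha_ i * x_ l)^-1)
    * \det (\matrix_(i0 < n, j0 < n)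
        let i := i0.+1 in let j := j0.+1 in
        esym_ominus
          ((at1 la i)%:Z - (at1 mu j)%:Z - i%:Z + j%:Z)
          (X_itv (at1 r j) (at1 s i))
          (Apar i.-1 - Apar j - Bpar (at1 la i) + Bpar (at1 mu j))).
Proof.
have [/andP[la_sorted _] /andP[mu_sorted _]] := (la_part, mu_part).
have la0 j : (n < j)%N -> at1 la j = 0%N.
  by move=> nj; rewrite /at1 nth_default //; lia.
have fc : flag_cond (at1 la) (at1 mu) (at1 r) (at1 s).
  (* [flag_cond] ranges over all i > 0; for i >= n the part la_{i+1} is 0, so its premise fails. *)
  move=> i i0 mui; have iln : (i < n)%N.
    by rewrite ltnNge; apply/negP => ni; rewrite la0 in mui; lia.
  have [] := rs_cond i _ mui; first by rewrite i0.
  lia.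
have -> : G_col r s (transpose la) (transpose mu) =
    tab_series (at1 mu) (at1 r) (at1 la) (at1 s).
  congr ms_sum; apply/seteqP; split=> T.
    case=> -[supp wfT rowT colT] flT.
    have suppE c : (c \in finsupp T) = in_shape (at1 mu) (at1 la) c.
      by rewrite supp in_skew_transpose.
    by split=> // [c|i j|i j|i j]; rewrite -!suppE; auto.
  case=> supp wfT rowT colT flT; split; last by move=> i j; rewrite supp; auto.
  split=> [c|c|i j|i j]; rewrite ?supp; auto.
  by rewrite in_skew_transpose.
rewrite big_add1 big_mkord.
exact: (tab_series_det (at1_noninc mu_sorted) r_gt0 (at1_noninc la_sorted) la0 mu_la fc).
Qed.
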